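(* Let $-1\le B<A\le 1$ and let $f$ be a function in Janowski's class with parameters $A,B$. Then $$|P_f(z)|\ge\frac{2-|A+B|\,|z|}{A-B}\qquad\text{for all } z\in\mathbb{D}.$$ The inequality is sharp.
   Context: $\mathbb{D}=\{z\in\mathbb{C}:|z|<1\}$. For $-1\le B<A\le 1$, Janowski's class (of Janowski convex functions) consists of the locally univalent analytic functions $f$ in $\mathbb{D}$ (that is, $f'\ne0$ in $\mathbb{D}$) satisfying the subordination $1+z\frac{f''(z)}{f'(z)}\prec\frac{1+Az}{1+Bz}$; that is, there is an analytic $h:\mathbb{D}\to\mathbb{D}$ with $h(0)=0$ and $1+z\frac{f''(z)}{f'(z)}=\frac{1+Ah(z)}{1+Bh(z)}$ for all $z\in\mathbb{D}$. The pole function (the pole of the best Möbius approximation of $f$ at $z$) is $P_f(z)=z+2\,f'(z)/f''(z)\in\mathbb{C}\cup\{\infty\}$, with $P_f(z)=\infty$ when $f''(z)=0$, and $|\infty|=+\infty$. *)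

(* Defs.v *)
From Stdlib Require Import Reals.
From Coquelicot Require Import Coquelicot.
Open Scope R_scope.

Definition unit_disk (z : C) : Prop := Cmod z < 1.

(* Analyticity is local representability by convergent power series.
   The functions are total on C; nothing is required outside the disk. *)
Definition analytic_at (f : C -> C) (z0 : C) : Prop :=
  exists (a : nat -> C) (r : R),
    0 < r /\
    forall z : C, Cmod (z - z0) < r ->
      @is_pseries C_AbsRing C_NormedModule a (z - z0)%C (f z).

Definition analytic_on_disk (f : C -> C) : Prop :=
  forall z : C, unit_disk z -> analytic_at f z.

Definition subordinate (F G : C -> C) : Prop :=
  exists h : C -> C,
    analytic_on_disk h /\
    (forall z : C, unit_disk z -> unit_disk (h z)) /\
    h (RtoC 0) = RtoC 0 /\
    forall z : C, unit_disk z -> F z = G (h z).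

(* [C_derive f z] is a total operator; it is the complex derivative wherever
   [f] is complex differentiable, in particular where [f] is analytic. *)
Definition d1 (f : C -> C) : C -> C := C_derive f.
Definition d2 (f : C -> C) : C -> C := C_derive (C_derive f).

Definition janowski (A B : R) (f : C -> C) : Prop :=
  analytic_on_disk f /\
  (forall z : C, unit_disk z -> d1 f z <> RtoC 0) /\
  subordinate (fun z : C => 1 + z * (d2 f z / d1 f z))%C
              (fun w : C => (1 + A * w) / (1 + B * w))%C.

(* Points of the extended plane: [None] is the point at infinity. *)
Definition ext_C : Type := option C.

Definition ext_Cmod (w : ext_C) : Rbar :=
  match w with
  | Some w => Finite (Cmod w)
  | None => p_infty
  end.

Definition pole (f : C -> C) (z : C) : ext_C :=
  if Ceq_dec (d2 f z) (RtoC 0) then None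
  else Some (z + 2 * (d1 f z / d2 f z))%C.

Definition pole_bound (A B : R) (z : C) : R :=
  (2 - Rabs (A + B) * Cmod z) / (A - B).

(* Main.v *)
Require Import Defs.
From Stdlib Require Import Reals Lra Lia ClassicalEpsilon Classical List.
From Coquelicot Require Import Coquelicot.
Open Scope R_scope.

(** Why the theorem holds.  Write [h] for the Schwarz function of [f].  Clearing
    denominators in the subordination gives
    [z f''/f' (1 + B h) = (A - B) h] ([pre_schwarzian_eq]), so that for [z <> 0]
      [P_f(z) = z + 2 f'/f'' = z (2 + (A + B) h) / ((A - B) h)].
    The Schwarz lemma [|h(z)| <= |z|] ([Schwarz_lemma]) turns the factor
    [|z| / |h|] into something at least [1], and the triangle inequality for
    [2 + (A + B) h] gives the bound.  At [z = 0] the subordination carries no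
    information; there the bound says [|f''(0)| <= (A - B) |f'(0)|], which follows
    by continuity of [f'] and [f''] from the estimates on small [z]
    ([pre_schwarzian_at_0]).

    For sharpness take [h(w) = c w] with [|c| = 1], where [c] is chosen so that
    [c (A + B) z = - |A + B| |z|] ([rotation_to_negative_axis]): then
    [|2 + (A + B) h(z)| = 2 - |A + B| |z|] exactly.  The function [f] must satisfy
    [(1 + B c w) f'' = (A - B) c f'], so [f'] is the binomial power
    [(1 + B c w)^((A - B) / B)] (an exponential when [B = 0]).  Building it by its
    power series treats all [B] alike: the recurrence for the coefficients and
    [|A - B| <= 2] give at most linear growth, hence convergence in the disk.  It has
    no zero since its product with the solution for [B - A] in place of [A - B] has
    derivative zero, hence is [1] ([binomial_neq_0], [extremal_exists]).

    Two classical facts on analytic functions are proved on the way.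

    A power series can be re-expanded at each point of its disk
    ([pseries_on_recenter]).  If [T(n, j)] is the coefficient of [w^j] in [(u + w)^n],
    the Taylor remainder [(u + w)^n - sum_(j < k) T(n, j) w^j] is at most
    [(|w| / d)^k (|u| + d)^n] when [|w| <= d]: a two-line induction by Pascal's rule
    ([shift_remainder_le]).  Summation against the coefficients of the series
    yields the new expansion with geometric convergence, and its linear coefficient
    is the term-by-term derivative.

    The maximum principle ([max_principle]) needs only second-order expansions.  The
    mean of [|g|^2] over the four points [z + t], [z - t], [z + i t], [z - i t] is at
    least [|g(z)|^2 - O(t^3)], while the mean of [|x|^2] exceeds [|z|^2] by exactly
    [t^2]; so [|g|^2 + e |x|^2] has no interior maximum on a disk, and [e -> 0].
    It is applied to [g(z) = h(z) / z]. *)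

Local Notation d1 := Defs.d1.
Local Notation d2 := Defs.d2.
Local Notation is_seriesC := (@is_series C_AbsRing C_NormedModule).
Local Notation is_pseriesC := (@is_pseries C_AbsRing C_NormedModule).

(** * Complex power series *)

(** Each term is the difference of two partial sums, and convergent sequences
    are bounded. *)
Lemma series_terms_bounded (u : nat -> C) (l : C) :
  is_seriesC u l -> exists M, 0 < M /\ forall n, Cmod (u n) <= M.
Proof.
  intros Hu.
  destruct (filterlim_bounded (K := C_AbsRing) (V := C_NormedModule) (sum_n u))
    as [M HM].
  { exists l. exact Hu. }
  assert (HM0 : 0 <= M).
  { apply Rle_trans with (2 := HM O). apply norm_ge_0. }
  exists (2 * M + 1). split; [lra|].
  intros n. change (Cmod (u n)) with (@norm C_AbsRing C_NormedModule (u n)).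
  destruct n as [|n].
  - rewrite <- (sum_O u). generalize (HM O). intros HM'.
    change (@norm C_AbsRing C_NormedModule (sum_n u 0) <= 2 * M + 1). lra.
  - assert (E : u (S n) = (sum_n u (S n) - sum_n u n)%C).
    { rewrite sum_Sn. change (u (S n) = (sum_n u n + u (S n) - sum_n u n)%C). ring. }
    rewrite E.
    generalize (HM n) (HM (S n)). intros H1 H2.
    change (Cmod (sum_n u (S n) - sum_n u n) <= 2 * M + 1).
    change (Cmod (sum_n u n) <= M) in H1. change (Cmod (sum_n u (S n)) <= M) in H2.
    unfold Cminus. generalize (Cmod_triangle (sum_n u (S n)) (- sum_n u n)).
    rewrite Cmod_opp. lra.
Qed.

Lemma series_norm_le (u : nat -> C) (l : C) (b : nat -> R) (B : R) :
  is_seriesC u l -> (forall n, Cmod (u n) <= b n) -> is_series b B -> Cmod l <= B.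
Proof.
  intros Hu Hub Hb.
  apply (filterlim_le (F := eventually)
    (fun n => @norm C_AbsRing C_NormedModule (sum_n u n)) (sum_n b)
    (Finite (Cmod l)) (Finite B)).
  - apply filter_forall. intros n. unfold sum_n.
    apply Rle_trans with (1 := norm_sum_n_m u 0 n).
    apply sum_n_m_le. exact Hub.
  - apply (filterlim_comp _ _ _ (sum_n u) (@norm C_AbsRing C_NormedModule)
      eventually (locally l) (locally (Cmod l))).
    + exact Hu.
    + exact (filterlim_norm (K := C_AbsRing) (V := C_NormedModule) l).
  - exact Hb.
Qed.

Lemma is_pseriesC_term (a : nat -> C) (w l : C) :
  is_pseriesC a w l <-> is_seriesC (fun n => a n * w ^ n)%C l.
Proof.
  split; apply is_series_ext; intros n; [|symmetry];
    exact (Cmult_comm (w ^ n) (a n)).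
Qed.

Lemma seriesC_unique (u : nat -> C) (l l' : C) :
  is_seriesC u l -> is_seriesC u l' -> l = l'.
Proof.
  exact (filterlim_locally_unique (K := C_AbsRing) (V := C_NormedModule)
    (F := eventually) (sum_n u) l l').
Qed.

Lemma pseries_unique (a : nat -> C) (w l l' : C) :
  is_pseriesC a w l -> is_pseriesC a w l' -> l = l'.
Proof. apply seriesC_unique. Qed.

(** Abel's lemma: the terms at [w] are bounded, so those at radius [s < |w|] are
    dominated by a geometric series. *)
Lemma pseries_abs_summable (a : nat -> C) (w l : C) (s : R) :
  is_pseriesC a w l -> 0 <= s < Cmod w ->
  ex_series (fun n => Cmod (a n) * s ^ n).
Proof.
  intros Hw [Hs0 Hs].
  apply (proj1 (is_pseriesC_term _ _ _)) in Hw.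
  destruct (series_terms_bounded _ _ Hw) as (M & HM & Hb).
  apply (ex_series_le (K := R_AbsRing) (V := R_CompleteNormedModule) _
    (fun n => M * (s / Cmod w) ^ n)).
  - intros n.
    assert (Hsn : 0 <= s ^ n) by (apply pow_le; lra).
    assert (Hwn : 0 < Cmod w ^ n) by (apply pow_lt; lra).
    change (Rabs (Cmod (a n) * s ^ n) <= M * (s / Cmod w) ^ n).
    rewrite Rabs_pos_eq by (apply Rmult_le_pos; [apply Cmod_ge_0 | lra]).
    specialize (Hb n). rewrite Cmod_mult, Cmod_pow in Hb.
    replace (Cmod (a n) * s ^ n)
      with (Cmod (a n) * Cmod w ^ n * (s / Cmod w) ^ n).
    + apply Rmult_le_compat_r; [|exact Hb].
      apply pow_le. apply Rmult_le_pos; [lra|].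
      apply Rlt_le, Rinv_0_lt_compat. lra.
    + unfold Rdiv. rewrite Rpow_mult_distr, pow_inv. field. lra.
  - apply (ex_series_scal_l (K := R_AbsRing) (V := R_NormedModule) M
      (fun n => (s / Cmod w) ^ n)). apply ex_series_geom.
    rewrite Rabs_pos_eq.
    + apply Rmult_lt_reg_r with (Cmod w); [lra|]. field_simplify; lra.
    + apply Rmult_le_pos; [lra|]. apply Rlt_le, Rinv_0_lt_compat. lra.
Qed.

Lemma ex_seriesC_le (u : nat -> C) (b : nat -> R) :
  (forall n, Cmod (u n) <= b n) -> ex_series b -> exists l, is_seriesC u l.
Proof.
  intros Hb Hex.
  exact (ex_series_le (K := C_AbsRing) (V := C_CompleteNormedModule) u b Hb Hex).
Qed.

(** The half-open convention ([N] terms, none for [N = 0]) makes a remainder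
    after [N] terms have order [|w|^N], which suits the inductions below. *)
Fixpoint partial_sum (c : nat -> C) (w : C) (N : nat) : C :=
  match N with
  | O => 0%C
  | S k => (partial_sum c w k + c k * w ^ k)%C
  end.

Lemma sum_n_partial_sum (c : nat -> C) (w : C) (N : nat) :
  sum_n (fun k => @scal C_AbsRing C_NormedModule (pow_n w k) (c k)) N
  = partial_sum c w (S N).
Proof.
  induction N as [|N IH].
  - rewrite sum_O. change ((w ^ 0 * c 0%nat)%C = (0 + c 0%nat * w ^ 0)%C). ring.
  - rewrite sum_Sn, IH.
    change ((partial_sum c w (S N) + w ^ S N * c (S N))%C
            = (partial_sum c w (S N) + c (S N) * w ^ S N)%C). ring.
Qed.

(** The coefficient [C(n, k) u^(n-k)] of [w^k] in [(u + w)^n], defined by Pascal's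
    rule because the remainder estimate is an induction along that rule. *)
Fixpoint shift_coef (u : C) (n k : nat) : C :=
  match n, k with
  | O, O => 1%C
  | O, S _ => 0%C
  | S m, O => (u * shift_coef u m O)%C
  | S m, S j => (u * shift_coef u m (S j) + shift_coef u m j)%C
  end.

(** The truncation of [(u + w) (u + w)^m]: multiplication by [w] raises the order,
    so one term fewer of the second factor is needed. *)
Lemma partial_sum_shift_S (u w : C) (m k : nat) :
  partial_sum (shift_coef u (S m)) w (S k)
  = (u * partial_sum (shift_coef u m) w (S k)
     + w * partial_sum (shift_coef u m) w k)%C.
Proof.
  induction k as [|k IH].
  - simpl. ring.
  - change (partial_sum (shift_coef u (S m)) w (S (S k)))
      with (partial_sum (shift_coef u (S m)) w (S k)
            + (u * shift_coef u m (S k) + shift_coef u m k) * w ^ S k)%C.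
    rewrite IH.
    change (partial_sum (shift_coef u m) w (S (S k)))
      with (partial_sum (shift_coef u m) w (S k) + shift_coef u m (S k) * w ^ S k)%C.
    change (partial_sum (shift_coef u m) w (S k))
      with (partial_sum (shift_coef u m) w k + shift_coef u m k * w ^ k)%C.
    rewrite !Cpow_S. ring.
Qed.

(** The remainder [R(n, k) = (u + w)^n - sum_(j < k) T(n, j) w^j] satisfies
    [R(n+1, k+1) = u R(n, k+1) + w R(n, k)], and the bound satisfies
    exactly this recurrence with [|u|] and [|w|] in place of [u] and [w]. *)
Lemma shift_remainder_le (u w : C) (d : R) (n k : nat) :
  0 < d -> Cmod w <= d ->
  Cmod ((u + w) ^ n - partial_sum (shift_coef u n) w k)%C
  <= (Cmod w / d) ^ k * (Cmod u + d) ^ n.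
Proof.
  intros Hd Hw.
  assert (Hq : 0 <= Cmod w / d).
  { apply Rmult_le_pos; [apply Cmod_ge_0|]. apply Rlt_le, Rinv_0_lt_compat, Hd. }
  assert (Hu := Cmod_ge_0 u).
  revert k. induction n as [|n IH]; intros k.
  - destruct k as [|k].
    + simpl. replace (1 - 0)%C with (RtoC 1) by ring. rewrite Cmod_1. lra.
    + assert (E : partial_sum (shift_coef u 0) w (S k) = 1%C).
      { clear. induction k as [|k IH]; [simpl; ring|].
        replace (partial_sum (shift_coef u 0) w (S (S k)))
          with (partial_sum (shift_coef u 0) w (S k) + 0 * w ^ S k)%C by reflexivity.
        rewrite IH. ring. }
      rewrite E. simpl Cpow. replace (1 - 1)%C with (RtoC 0) by ring.
      rewrite Cmod_0. simpl pow at 2. rewrite Rmult_1_r. apply pow_le, Hq.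
  - destruct k as [|k].
    + change (Cmod ((u + w) ^ S n - 0) <= 1 * (Cmod u + d) ^ S n).
      replace ((u + w) ^ S n - 0)%C with ((u + w) ^ S n)%C by ring.
      rewrite Cmod_pow, Rmult_1_l. apply pow_incr.
      split; [apply Cmod_ge_0|]. generalize (Cmod_triangle u w). lra.
    + rewrite partial_sum_shift_S.
      replace ((u + w) ^ S n - (u * partial_sum (shift_coef u n) w (S k)
               + w * partial_sum (shift_coef u n) w k))%C
        with (u * ((u + w) ^ n - partial_sum (shift_coef u n) w (S k))
              + w * ((u + w) ^ n - partial_sum (shift_coef u n) w k))%C
        by (rewrite Cpow_S; ring).
      apply Rle_trans with (1 := Cmod_triangle _ _).
      rewrite !Cmod_mult.
      apply Rle_trans with
        (Cmod u * ((Cmod w / d) ^ S k * (Cmod u + d) ^ n)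
         + Cmod w * ((Cmod w / d) ^ k * (Cmod u + d) ^ n)).
      * apply Rplus_le_compat; apply Rmult_le_compat_l;
          try apply Cmod_ge_0; apply IH.
      * apply Req_le. simpl. field. lra.
Qed.

Lemma shift_coef_le (u : C) (d : R) (n k : nat) :
  0 < d -> Cmod (shift_coef u n k) <= / d ^ k * (Cmod u + d) ^ n.
Proof.
  intros Hd.
  assert (Hu := Cmod_ge_0 u).
  revert k. induction n as [|n IH]; intros k.
  - destruct k as [|k]; simpl.
    + rewrite Cmod_1. lra.
    + rewrite Cmod_0, Rmult_1_r. apply Rlt_le, Rinv_0_lt_compat.
      apply Rmult_lt_0_compat; [lra | apply pow_lt, Hd].
  - assert (Hdk : 0 < d ^ k) by (apply pow_lt, Hd).
    destruct k as [|k].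
    + simpl. rewrite Cmod_mult. specialize (IH O). simpl in IH.
      rewrite Rinv_1, Rmult_1_l in *.
      apply Rmult_le_compat; try apply Cmod_ge_0; lra.
    + change (Cmod (u * shift_coef u n (S k) + shift_coef u n k)
              <= / d ^ S k * (Cmod u + d) ^ S n).
      apply Rle_trans with (1 := Cmod_triangle _ _). rewrite Cmod_mult.
      apply Rle_trans with (Cmod u * (/ d ^ S k * (Cmod u + d) ^ n)
                            + / d ^ k * (Cmod u + d) ^ n).
      * apply Rplus_le_compat; [apply Rmult_le_compat_l|]; auto.
      * apply Req_le. simpl in *. field. split; [|lra]. apply pow_nonzero. lra.
Qed.

Lemma shift_coef_0 (u : C) (n : nat) : shift_coef u n 0 = (u ^ n)%C.
Proof.
  induction n as [|n IH]; [reflexivity|].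
  simpl shift_coef. rewrite IH. reflexivity.
Qed.

Lemma shift_coef_1 (u : C) (n : nat) :
  shift_coef u (S n) 1 = (RtoC (INR (S n)) * u ^ n)%C.
Proof.
  induction n as [|n IH].
  - simpl. ring.
  - change (shift_coef u (S (S n)) 1)
      with (u * shift_coef u (S n) 1 + shift_coef u (S n) 0)%C.
    rewrite IH, shift_coef_0, (S_INR (S n)), RtoC_plus, !Cpow_S. ring.
Qed.

(** The new coefficients are the columns [c_k = sum_n a_n T(n, k)].  By
    [shift_remainder_le] the remainder after [k] terms is at most
    [(|w| / d)^k sum_n |a_n| (|u| + d)^n], so the double sum need never be
    rearranged. *)
Lemma pseries_shift (a : nat -> C) (u : C) (d : R) :
  0 < d -> ex_series (fun n => Cmod (a n) * (Cmod u + d) ^ n) ->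
  exists c : nat -> C,
    (forall k, is_seriesC (fun n => a n * shift_coef u n k)%C (c k)) /\
    forall w s, Cmod w < d -> is_pseriesC a (u + w)%C s -> is_pseriesC c w s.
Proof.
  intros Hd [B HB].
  assert (Hex : forall k, exists l, is_seriesC (fun n => a n * shift_coef u n k)%C l).
  { intros k.
    apply ex_seriesC_le with (fun n => / d ^ k * (Cmod (a n) * (Cmod u + d) ^ n)).
    - intros n. rewrite Cmod_mult.
      replace (/ d ^ k * (Cmod (a n) * (Cmod u + d) ^ n))
        with (Cmod (a n) * (/ d ^ k * (Cmod u + d) ^ n)) by ring.
      apply Rmult_le_compat_l; [apply Cmod_ge_0 | apply shift_coef_le, Hd].
    - apply (ex_series_scal_l (K := R_AbsRing) (V := R_NormedModule) (/ d ^ k)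
        (fun n => Cmod (a n) * (Cmod u + d) ^ n)). exists B. exact HB. }
  exists (fun k => proj1_sig (constructive_indefinite_description _ (Hex k))).
  set (c := fun k => proj1_sig (constructive_indefinite_description _ (Hex k))).
  assert (Hc : forall k, is_seriesC (fun n => a n * shift_coef u n k)%C (c k)).
  { intros k. unfold c. apply proj2_sig. }
  split; [exact Hc|].
  intros w s Hw Hs. apply (proj1 (is_pseriesC_term _ _ _)) in Hs.
  (* Column by column: the series of the truncations is the truncated new series. *)
  assert (Hpart : forall k,
    is_seriesC (fun n => a n * partial_sum (shift_coef u n) w k)%C (partial_sum c w k)).
  { induction k as [|k IH].
    - apply is_series_ext with (fun n => @scal C_AbsRing C_NormedModule (RtoC 0) (a n * (u + w) ^ n)%C).
      + intros n. change ((0 * (a n * (u + w) ^ n))%C = (a n * 0)%C). ring.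
      + assert (Z := is_series_scal (K := C_AbsRing) (V := C_NormedModule) (RtoC 0) _ _ Hs).
        change (scal (RtoC 0) s) with (RtoC 0 * s)%C in Z.
        rewrite Cmult_0_l in Z. exact Z.
    - apply is_series_ext with (fun n => @plus C_NormedModule
        (a n * partial_sum (shift_coef u n) w k)%C
        (@scal C_AbsRing C_NormedModule (w ^ k)%C (a n * shift_coef u n k)%C)).
      + intros n.
        change ((a n * partial_sum (shift_coef u n) w k
                 + w ^ k * (a n * shift_coef u n k))%C
          = (a n * (partial_sum (shift_coef u n) w k + shift_coef u n k * w ^ k))%C).
        ring.
      + replace (partial_sum c w (S k)) with (@plus C_NormedModule
          (partial_sum c w k) (@scal C_AbsRing C_NormedModule (w ^ k)%C (c k))).
        * apply (is_series_plus (K := C_AbsRing) (V := C_NormedModule)); [exact IH|].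
          apply (is_series_scal (K := C_AbsRing) (V := C_NormedModule)). apply Hc.
        * change ((partial_sum c w k + w ^ k * c k)%C
                  = (partial_sum c w k + c k * w ^ k)%C). ring. }
  assert (Hq : 0 <= Cmod w / d).
  { apply Rmult_le_pos; [apply Cmod_ge_0|]. apply Rlt_le, Rinv_0_lt_compat, Hd. }
  assert (Hrem : forall k, Cmod (partial_sum c w k - s) <= (Cmod w / d) ^ k * B).
  { intros k.
    apply series_norm_le with
      (u := fun n => (a n * (partial_sum (shift_coef u n) w k - (u + w) ^ n))%C)
      (b := fun n => (Cmod w / d) ^ k * (Cmod (a n) * (Cmod u + d) ^ n)).
    - apply is_series_ext with (fun n => @plus C_NormedModule
        (a n * partial_sum (shift_coef u n) w k)%C
        (@opp C_NormedModule (a n * (u + w) ^ n)%C)).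
      + intros n. change ((a n * partial_sum (shift_coef u n) w k - a n * (u + w) ^ n)%C
          = (a n * (partial_sum (shift_coef u n) w k - (u + w) ^ n))%C). ring.
      + apply (is_series_minus (K := C_AbsRing) (V := C_NormedModule));
          [apply Hpart | exact Hs].
    - intros n. rewrite Cmod_mult.
      replace ((Cmod w / d) ^ k * (Cmod (a n) * (Cmod u + d) ^ n))
        with (Cmod (a n) * ((Cmod w / d) ^ k * (Cmod u + d) ^ n)) by ring.
      apply Rmult_le_compat_l; [apply Cmod_ge_0|].
      rewrite <- Cmod_opp, Copp_minus_distr.
      apply shift_remainder_le; lra.
    - apply (is_series_scal (K := R_AbsRing) (V := R_NormedModule)). exact HB. }
  unfold is_pseries, is_series.
  apply (filterlim_ext (fun N => partial_sum c w (S N))).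
  { intros N. symmetry. apply sum_n_partial_sum. }
  assert (Hlim : is_lim_seq (fun k => (Cmod w / d) ^ k * B) 0).
  { replace (Finite 0) with (Rbar_mult (Finite 0) (Finite B))
      by (simpl; f_equal; ring).
    apply is_lim_seq_scal_r. apply is_lim_seq_geom.
    rewrite Rabs_pos_eq by exact Hq.
    apply Rmult_lt_reg_r with d; [lra|]. field_simplify; lra. }
  apply (filterlim_locally_ball_norm (K := C_AbsRing) (U := C_NormedModule)).
  intros eps.
  destruct (proj2 (is_lim_seq_spec _ _) Hlim eps) as [N HN].
  exists N. intros n Hn.
  specialize (HN (S n) (le_S _ _ Hn)).
  change (Cmod (partial_sum c w (S n) - s) < eps).
  apply Rle_lt_trans with (1 := Hrem (S n)).
  apply Rle_lt_trans with (2 := HN). rewrite Rminus_0_r. apply Rle_abs.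
Qed.

Definition pseries_on (a : nat -> C) (f : C -> C) (z0 : C) (r : R) : Prop :=
  forall z, Cmod (z - z0) < r -> is_pseriesC a (z - z0)%C (f z).

(** Factor [(|w| / p)^N] out of the tail, with [p] half the radius; what is left
    is dominated by a geometric series. *)
Lemma pseries_remainder_le (a : nat -> C) (f : C -> C) (z0 : C) (r : R) (N : nat) :
  0 < r -> pseries_on a f z0 r ->
  exists K d, 0 < K /\ 0 < d /\ forall w, Cmod w < d ->
    Cmod (f (z0 + w) - partial_sum a w N)%C <= K * Cmod w ^ N.
Proof.
  intros Hr Hf.
  set (p := r / 2).
  assert (Hp : 0 < p < r) by (unfold p; lra).
  assert (Hmp : Cmod (RtoC p) = p) by (rewrite Cmod_R; apply Rabs_pos_eq; lra).
  assert (Hb : is_pseriesC a (RtoC p) (f (z0 + RtoC p)%C)).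
  { replace (RtoC p) with (z0 + RtoC p - z0)%C at 1 by ring. apply Hf.
    replace (z0 + RtoC p - z0)%C with (RtoC p) by ring. lra. }
  apply (proj1 (is_pseriesC_term _ _ _)) in Hb.
  destruct (series_terms_bounded _ _ Hb) as (M & HM & HMb).
  exists (2 * M / p ^ N), (p / 2).
  assert (HpN : 0 < p ^ N) by (apply pow_lt; lra).
  split; [apply Rdiv_lt_0_compat; lra|]. split; [lra|].
  intros w Hw.
  assert (Hw0 := Cmod_ge_0 w).
  assert (Hq : 0 <= Cmod w / p <= / 2).
  { split.
    - apply Rmult_le_pos; [lra|]. apply Rlt_le, Rinv_0_lt_compat; lra.
    - apply Rmult_le_reg_r with p; [lra|]. field_simplify; lra. }
  assert (Hs : is_pseriesC a w (f (z0 + w)%C)).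
  { replace w with (z0 + w - z0)%C at 1 by ring. apply Hf.
    replace (z0 + w - z0)%C with w by ring. lra. }
  apply series_norm_le with (u := fun k => (a (N + k)%nat * w ^ (N + k))%C)
    (b := fun k => M * (Cmod w / p) ^ N * (/ 2) ^ k).
  - destruct N as [|N].
    + simpl. replace (f (z0 + w) - 0)%C with (f (z0 + w)%C) by ring.
      apply (proj1 (is_pseriesC_term _ _ _)) in Hs. exact Hs.
    + apply (is_series_incr_n (K := C_AbsRing) (V := C_NormedModule)
        (fun k => (a k * w ^ k)%C) (S N)); [lia|].
      assert (E : sum_n (fun k => (a k * w ^ k)%C) N = partial_sum a w (S N)).
      { rewrite <- sum_n_partial_sum. apply sum_n_ext. intros n.
        exact (Cmult_comm (a n) (w ^ n)). }
      match goal with |- is_series _ ?X => replace X with (f (z0 + w)%C) end.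
      * exact (proj1 (is_pseriesC_term _ _ _) Hs).
      * transitivity (f (z0 + w) - partial_sum a w (S N) + partial_sum a w (S N))%C; [ring|].
        apply (f_equal (Cplus (f (z0 + w) - partial_sum a w (S N))%C)).
        symmetry. exact E.
  - intros k. rewrite Cmod_mult, Cmod_pow.
    specialize (HMb (N + k)%nat). rewrite Cmod_mult, Cmod_pow, Hmp in HMb.
    replace (Cmod (a (N + k)%nat) * Cmod w ^ (N + k))
      with ((Cmod (a (N + k)%nat) * p ^ (N + k)) * ((Cmod w / p) ^ N * (Cmod w / p) ^ k)).
    + rewrite (Rmult_assoc M). apply Rmult_le_compat; try lra.
      * apply Rmult_le_pos; [apply Cmod_ge_0 | apply pow_le; lra].
      * apply Rmult_le_pos; apply pow_le; lra.
      * apply Rmult_le_compat_l; [apply pow_le; lra | apply pow_incr; lra].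
    + rewrite <- pow_add. unfold Rdiv. rewrite Rpow_mult_distr, pow_inv.
      field. apply pow_nonzero. lra.
  - replace (2 * M / p ^ N * Cmod w ^ N)
      with (@scal R_AbsRing R_NormedModule (M * (Cmod w / p) ^ N) (/ (1 - / 2))).
    + apply (is_series_scal (K := R_AbsRing) (V := R_NormedModule)).
      apply is_series_geom. rewrite Rabs_pos_eq; lra.
    + change (M * (Cmod w / p) ^ N * (/ (1 - / 2)) = 2 * M / p ^ N * Cmod w ^ N).
      unfold Rdiv. rewrite Rpow_mult_distr, pow_inv. field. lra.
Qed.

Lemma pseries_on_center (a : nat -> C) (f : C -> C) (z0 : C) (r : R) :
  0 < r -> pseries_on a f z0 r -> f z0 = a O.
Proof.
  intros Hr Hf.
  destruct (pseries_remainder_le a f z0 r 1 Hr Hf) as (K & d & HK & Hd & Hb).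
  specialize (Hb (RtoC 0)). rewrite Cmod_0 in Hb. specialize (Hb Hd).
  simpl in Hb. rewrite Rmult_0_l, Rmult_0_r in Hb.
  replace (f (z0 + 0) - (0 + a 0%nat * 1))%C with (f z0 - a O)%C in Hb
    by (replace (z0 + 0)%C with z0 by ring; ring).
  assert (Z := Cmod_eq_0 (f z0 - a O) (Rle_antisym _ _ Hb (Cmod_ge_0 _))).
  replace (f z0) with (f z0 - a O + a O)%C by ring. rewrite Z. ring.
Qed.


(** * Complex derivatives *)

(** The form of differentiability that interacts directly with Taylor remainders. *)
Lemma is_derive_C_eps (f : C -> C) (z l : C) :
  @is_derive C_AbsRing C_NormedModule f z l <->
  forall eps, 0 < eps -> exists d, 0 < d /\ forall w, Cmod w < d ->
    Cmod (f (z + w) - f z - w * l)%C <= eps * Cmod w.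
Proof.
  split.
  - intros [_ Hd] eps Heps.
    specialize (Hd z (fun P H => H) (mkposreal eps Heps)).
    destruct Hd as [d Hd]. exists d. split; [apply cond_pos|].
    intros w Hw.
    assert (E : (z + w - z)%C = w) by ring.
    specialize (Hd (z + w)%C).
    change (Cmod (z + w - z) < d ->
      Cmod (f (z + w) - f z - (z + w - z) * l) <= eps * Cmod (z + w - z))%C in Hd.
    rewrite E in Hd. apply Hd, Hw.
  - intros H. split.
    + apply (is_linear_scal_l (K := C_AbsRing) (V := C_NormedModule) l).
    + intros x Hx.
      assert (Ex : x = z).
      { symmetry. exact (is_filter_lim_locally_unique (K := C_AbsRing)
          (V := AbsRing_NormedModule C_AbsRing) z x Hx). }
      subst x. intros eps.
      destruct (H eps (cond_pos eps)) as (d & Hd & Hb).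
      exists (mkposreal d Hd). intros y Hy.
      change (Cmod (y - z) < d)%C in Hy.
      specialize (Hb (y - z)%C Hy).
      assert (E : @eq C (z + (y - z))%C y) by (unfold Cminus; ring).
      rewrite E in Hb. exact Hb.
Qed.

Lemma pseries_on_is_derive (a : nat -> C) (f : C -> C) (z0 : C) (r : R) :
  0 < r -> pseries_on a f z0 r -> @is_derive C_AbsRing C_NormedModule f z0 (a 1%nat).
Proof.
  intros Hr Hf. apply is_derive_C_eps. intros eps Heps.
  destruct (pseries_remainder_le a f z0 r 2 Hr Hf) as (K & d & HK & Hd & Hb).
  assert (E0 := pseries_on_center a f z0 r Hr Hf).
  exists (Rmin d (eps / K)). split.
  { apply Rmin_pos; [exact Hd|]. apply Rdiv_lt_0_compat; lra. }
  intros w Hw.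
  assert (Hw1 : Cmod w < d) by (apply Rlt_le_trans with (1 := Hw), Rmin_l).
  assert (Hw2 : Cmod w < eps / K) by (apply Rlt_le_trans with (1 := Hw), Rmin_r).
  specialize (Hb w Hw1). simpl in Hb.
  replace (f (z0 + w) - f z0 - w * a 1%nat)%C
    with (f (z0 + w) - (0 + a 0%nat * 1 + a 1%nat * (w * 1)))%C by (rewrite E0; ring).
  apply Rle_trans with (1 := Hb).
  rewrite Rmult_1_r, <- Rmult_assoc. apply Rmult_le_compat_r; [apply Cmod_ge_0|].
  apply Rmult_le_reg_l with (/ K); [apply Rinv_0_lt_compat, HK|].
  rewrite <- Rmult_assoc, Rinv_l, Rmult_1_l by lra.
  rewrite Rmult_comm. apply Rlt_le, Hw2.
Qed.

Definition PS_derivC (a : nat -> C) (n : nat) : C := (RtoC (INR (S n)) * a (S n))%C.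

(** The re-expansion at [z1]; its linear coefficient, which is the derivative of
    [f] at [z1], is the value there of the term-by-term derivative because
    [T(n, 1) = n u^(n-1)]. *)
Lemma pseries_on_recenter (a : nat -> C) (f : C -> C) (z0 : C) (r : R) (z1 : C) :
  pseries_on a f z0 r -> Cmod (z1 - z0) < r ->
  exists c r', 0 < r' /\ pseries_on c f z1 r' /\
    is_pseriesC (PS_derivC a) (z1 - z0)%C (c 1%nat).
Proof.
  intros Hf Hz. set (u := (z1 - z0)%C) in *. assert (Hu := Cmod_ge_0 u).
  (* A third, so that [|u| + d] stays below the radius [|u| + 2 d < r] at which the
     series converges. *)
  set (d := (r - Cmod u) / 3).
  assert (Hd : 0 < d) by (unfold d; lra).
  destruct (pseries_shift a u d Hd) as (c & Hc & Hs).
  { set (x := RtoC (Cmod u + 2 * d)).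
    assert (Hx : Cmod x = Cmod u + 2 * d).
    { unfold x. rewrite Cmod_R. apply Rabs_pos_eq. lra. }
    apply pseries_abs_summable with x (f (z0 + x)%C).
    - replace x with (z0 + x - z0)%C at 1 by ring. apply Hf.
      replace (z0 + x - z0)%C with x by ring. rewrite Hx. unfold d. lra.
    - rewrite Hx. lra. }
  exists c, d. split; [exact Hd|]. split.
  - intros z Hzz. apply Hs; [exact Hzz|].
    replace (u + (z - z1))%C with (z - z0)%C by (unfold u; ring).
    apply Hf. replace (z - z0)%C with (u + (z - z1))%C by (unfold u; ring).
    generalize (Cmod_triangle u (z - z1)%C). unfold d in Hzz. lra.
  - apply is_pseriesC_term.
    apply is_series_ext with (fun n => a (S n) * shift_coef u (S n) 1)%C.
    { intros n. rewrite shift_coef_1. unfold PS_derivC.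
      change (a (S n) * (INR (S n) * u ^ n) = INR (S n) * a (S n) * u ^ n)%C. ring. }
    apply (is_series_incr_1 (K := C_AbsRing) (V := C_NormedModule)
      (fun n => (a n * shift_coef u n 1)%C)).
    match goal with |- is_series _ ?X => replace X with (c 1%nat) end; [apply Hc|].
    change (c 1%nat = c 1%nat + a 0%nat * 0)%C. ring.
Qed.

Lemma pseries_on_derive (a : nat -> C) (f : C -> C) (z0 : C) (r : R) (z : C) :
  pseries_on a f z0 r -> Cmod (z - z0) < r ->
  @is_derive C_AbsRing C_NormedModule f z (C_derive f z).
Proof.
  intros Hf Hz.
  destruct (pseries_on_recenter a f z0 r z Hf Hz) as (c & r' & Hr' & Hc & _).
  assert (H := pseries_on_is_derive c f z r' Hr' Hc).
  rewrite (is_C_derive_unique f z _ H). exact H.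
Qed.

(** Term-by-term differentiation, valid on the whole disk of convergence. *)
Lemma pseries_on_C_derive (a : nat -> C) (f : C -> C) (z0 : C) (r : R) :
  pseries_on a f z0 r -> pseries_on (PS_derivC a) (C_derive f) z0 r.
Proof.
  intros Hf z Hz.
  destruct (pseries_on_recenter a f z0 r z Hf Hz) as (c & r' & Hr' & Hc & H1).
  rewrite (is_C_derive_unique f z _ (pseries_on_is_derive c f z r' Hr' Hc)).
  exact H1.
Qed.

Lemma analytic_at_C_derive (f : C -> C) (z : C) :
  analytic_at f z -> analytic_at (C_derive f) z.
Proof.
  intros (a & r & Hr & Hf). exists (PS_derivC a), r.
  split; [exact Hr|]. exact (pseries_on_C_derive a f z r Hf).
Qed.

Lemma pseries_on_analytic (a : nat -> C) (f : C -> C) (z0 : C) (r : R) (z : C) :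
  pseries_on a f z0 r -> Cmod (z - z0) < r -> analytic_at f z.
Proof.
  intros Hf Hz.
  destruct (pseries_on_recenter a f z0 r z Hf Hz) as (c & r' & Hr' & Hc & _).
  exists c, r'. split; assumption.
Qed.

Lemma analytic_at_expand (f : C -> C) (z0 : C) (N : nat) :
  analytic_at f z0 -> exists a K d, 0 < K /\ 0 < d /\ f z0 = a O /\
    forall w, Cmod w < d -> Cmod (f (z0 + w) - partial_sum a w N)%C <= K * Cmod w ^ N.
Proof.
  intros (a & r & Hr & Hf).
  destruct (pseries_remainder_le a f z0 r N Hr Hf) as (K & d & HK & Hd & H).
  exists a, K, d. repeat split; auto. apply pseries_on_center with r; assumption.
Qed.

Lemma analytic_at_continuous (f : C -> C) (z : C) :
  analytic_at f z -> forall eps, 0 < eps -> exists d, 0 < d /\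
    forall w, Cmod w < d -> Cmod (f (z + w) - f z)%C <= eps.
Proof.
  intros Hf eps Heps.
  destruct (analytic_at_expand f z 1 Hf) as (a & K & d & HK & Hd & E & H).
  exists (Rmin d (eps / K)).
  split; [apply Rmin_pos; [exact Hd | apply Rdiv_lt_0_compat; lra]|].
  intros w Hw. specialize (H w (Rlt_le_trans _ _ _ Hw (Rmin_l _ _))).
  assert (HwK := Rlt_le_trans _ _ _ Hw (Rmin_r _ _)).
  simpl in H. rewrite <- E, Rmult_1_r in H.
  replace (f (z + w) - f z)%C with (f (z + w) - (0 + f z * 1))%C by ring.
  apply Rle_trans with (1 := H).
  apply Rle_trans with (K * (eps / K)); [apply Rmult_le_compat_l; lra|].
  apply Req_le. field. lra.
Qed.



(** The complex plane carries two normed-module structures over itself: the one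
    derived from the product [R * R] and the one every valued ring has.  They share
    norm and neighbourhoods, so derivatives can be moved to the second, where
    functions can be multiplied. *)
Lemma is_derive_C_AbsRing (f : C -> C) (z l : C) :
  @is_derive C_AbsRing C_NormedModule f z l <->
  @is_derive C_AbsRing (AbsRing_NormedModule C_AbsRing) f z l.
Proof.
  split; intros [[L1 L2 L3] Hd]; (split; [constructor; assumption | exact Hd]).
Qed.

Lemma is_derive_C_mult (f g : C -> C) (z f' g' : C) :
  @is_derive C_AbsRing C_NormedModule f z f' ->
  @is_derive C_AbsRing C_NormedModule g z g' ->
  @is_derive C_AbsRing C_NormedModule (fun x => f x * g x)%C z (f' * g z + f z * g')%C.
Proof.
  intros Hf Hg. apply is_derive_C_AbsRing.
  apply (is_derive_mult (K := C_AbsRing) f g z f' g').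
  - apply is_derive_C_AbsRing, Hf.
  - apply is_derive_C_AbsRing, Hg.
  - exact Cmult_comm.
Qed.

(** Along a segment the function has zero real derivative. *)
Lemma is_derive_C_zero_constant (f : C -> C) (z0 : C) (r : R) :
  (forall z, Cmod (z - z0) < r -> @is_derive C_AbsRing C_NormedModule f z (RtoC 0)) ->
  forall z, Cmod (z - z0) < r -> f z = f z0.
Proof.
  intros Hf z Hz.
  set (p := fun t : R => f (z0 + t * (z - z0))%C).
  assert (Hp : forall t, 0 <= t <= 1 -> @is_derive R_AbsRing C_R_NormedModule p t zero).
  { intros t Ht. split.
    - apply (is_linear_scal_l (K := R_AbsRing) (V := C_R_NormedModule) zero).
    - intros x Hx.
      assert (Ex : x = t).
      { symmetry. exact (is_filter_lim_locally_unique (K := R_AbsRing)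
          (V := R_NormedModule) t x Hx). }
      subst x. intros eps.
      assert (Hin : Cmod (z0 + t * (z - z0) - z0) < r).
      { replace (z0 + t * (z - z0) - z0)%C with (t * (z - z0))%C by ring.
        rewrite Cmod_mult, Cmod_R, Rabs_pos_eq by lra.
        apply Rle_lt_trans with (2 := Hz). rewrite <- (Rmult_1_l (Cmod (z - z0))) at 2.
        apply Rmult_le_compat_r; [apply Cmod_ge_0 | lra]. }
      set (m := Cmod (z - z0) + 1).
      assert (Hm : 0 < m) by (unfold m; generalize (Cmod_ge_0 (z - z0)%C); lra).
      assert (He : 0 < eps / m) by (apply Rdiv_lt_0_compat; [apply cond_pos | exact Hm]).
      destruct (proj1 (is_derive_C_eps _ _ _) (Hf _ Hin) _ He) as (d & Hd & Hb).
      assert (Hdm : 0 < d / m) by (apply Rdiv_lt_0_compat; assumption).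
      exists (mkposreal _ Hdm). intros y Hy.
      change (Rabs (y - t) < d / m) in Hy.
      change (@norm R_AbsRing C_R_NormedModule
        (minus (minus (p y) (p t)) (scal (minus y t) zero)) <= eps * Rabs (y - t)).
      match goal with |- norm ?X <= _ => assert (EX : X = (p y - p t)%C) end.
      { apply injective_projections; unfold minus, plus, opp, scal, zero, mult; simpl;
          unfold minus, plus, opp, scal, zero, mult; simpl;
          match goal with |- ?A + - mult ?B ?D = ?E => change (A + - (B * D) = E) end; ring. }
      rewrite EX, <- Cmod_norm.
      assert (Hw : Cmod ((y - t)%R * (z - z0)) <= Rabs (y - t) * m).
      { rewrite Cmod_mult, Cmod_R. apply Rmult_le_compat_l; [apply Rabs_pos|].
        unfold m. lra. }
      assert (Hw' : Cmod ((y - t)%R * (z - z0)) < d).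
      { apply Rle_lt_trans with (1 := Hw).
        apply Rmult_lt_reg_r with (/ m); [apply Rinv_0_lt_compat, Hm|].
        rewrite Rmult_assoc, Rinv_r, Rmult_1_r by lra. exact Hy. }
      specialize (Hb _ Hw').
      replace (z0 + t * (z - z0) + (y - t)%R * (z - z0))%C
        with (z0 + y * (z - z0))%C in Hb by (rewrite RtoC_minus; ring).
      replace (f (z0 + y * (z - z0)) - f (z0 + t * (z - z0)) - (y - t)%R * (z - z0) * 0)%C
        with (p y - p t)%C in Hb by (unfold p; ring).
      apply Rle_trans with (1 := Hb).
      apply Rle_trans with (eps / m * (Rabs (y - t) * m)).
      + apply Rmult_le_compat_l; lra.
      + apply Req_le. field. lra. }
  assert (E := eq_is_derive p 0 1 Hp Rlt_0_1).
  unfold p in E.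
  replace (z0 + 0 * (z - z0))%C with z0 in E by ring.
  replace (z0 + 1 * (z - z0))%C with z in E by ring. symmetry. exact E.
Qed.

(** * The maximum principle *)

(** Spelled out with the modulus, since the neighbourhoods of the plane seen as a
    product are squares. *)
Definition eps_continuous_at (u : C -> R) (z : C) :=
  forall eps, 0 < eps -> exists d, 0 < d /\
    forall w, Cmod (w - z) < d -> Rabs (u w - u z) < eps.

Lemma Cmod_le_Rabs (z : C) : Cmod z <= Rabs (fst z) + Rabs (snd z).
Proof.
  destruct z as [x y]. simpl.
  replace (x, y) with (RtoC x + Ci * RtoC y)%C.
  - apply Rle_trans with (1 := Cmod_triangle _ _).
    rewrite Cmod_mult, Cmod_Ci, !Cmod_R. lra.
  - unfold Cplus, Cmult, Ci, RtoC. simpl. f_equal; ring.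
Qed.

(** By contradiction: if no point is maximal, each [z] has a [z'] in the disk with
    [u w < u z'] for all [w] near [z].  Finitely many of these neighbourhoods cover
    the disk; the best [v] among the finitely many [z'] lies in one of them, so that
    [u v] is smaller than one of the values it dominates. *)
Lemma closed_disk_max (u : C -> R) (r : R) :
  0 <= r -> (forall z, Cmod z <= r -> eps_continuous_at u z) ->
  exists z, Cmod z <= r /\ forall w, Cmod w <= r -> u w <= u z.
Proof.
  intros Hr Hu. apply NNPP. intros Hno.
  assert (Hup : forall z, Cmod z <= r -> exists z', Cmod z' <= r /\ u z < u z').
  { intros z Hz. apply NNPP. intros Hn. apply Hno. exists z. split; [exact Hz|].
    intros w Hw. destruct (Rle_lt_dec (u w) (u z)) as [H|H]; [exact H|].
    exfalso. apply Hn. exists w. split; assumption. }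
  (* The finite cover is one of the square [-r, r]^2; a point of the square outside
     the disk gets a neighbourhood that misses the disk, and a dummy target [0]. *)
  assert (Hch : forall p : Compactness.Tn 2 R, exists q : posreal * C,
    let z := (fst p, fst (snd p)) : C in
    Cmod (snd q) <= r /\
    forall w, Cmod w <= r -> Cmod (w - z) < 2 * fst q -> u w < u (snd q)).
  { intros [x [y []]]. simpl. set (z := (x, y) : C).
    destruct (Rle_lt_dec (Cmod z) r) as [Hz|Hz].
    - destruct (Hup z Hz) as (z' & Hz' & Hlt).
      destruct (Hu z Hz (u z' - u z)) as (d & Hd & Hc); [lra|].
      assert (Hd2 : 0 < d / 2) by lra.
      exists (mkposreal _ Hd2, z'). simpl. split; [exact Hz'|].
      intros w Hw Hwz. assert (Hwd : Cmod (w - z) < d) by lra.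
      generalize (Hc w Hwd) (Rle_abs (u w - u z)). lra.
    - assert (Hd2 : 0 < (Cmod z - r) / 2) by lra.
      exists (mkposreal _ Hd2, RtoC 0). simpl. split; [rewrite Cmod_0; exact Hr|].
      intros w Hw Hwz. exfalso.
      assert (Ht := Cmod_triangle w (z - w)%C).
      replace (w + (z - w))%C with z in Ht by ring.
      rewrite <- (Cmod_opp (z - w)), Copp_minus_distr in Ht. lra. }
  set (q := fun p => proj1_sig (constructive_indefinite_description _ (Hch p))).
  assert (Hq : forall p : Compactness.Tn 2 R, let z := (fst p, fst (snd p)) : C in
    Cmod (snd (q p)) <= r /\
    forall w, Cmod w <= r -> Cmod (w - z) < 2 * fst (q p) -> u w < u (snd (q p))).
  { intros p. exact (proj2_sig (constructive_indefinite_description _ (Hch p))). }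
  apply (compactness_list 2 (- r, (- r, tt)) (r, (r, tt)) (fun p => fst (q p))).
  intros [l Hl].
  assert (Hv : exists v, Cmod v <= r /\ forall t, In t l -> u (snd (q t)) <= u v).
  { clear Hl. induction l as [|t l IH].
    - exists (RtoC 0). split; [rewrite Cmod_0; exact Hr|]. intros t [].
    - destruct IH as (v & Hv & Hle).
      destruct (Rle_lt_dec (u v) (u (snd (q t)))) as [H|H].
      + exists (snd (q t)). split; [apply Hq|].
        intros t' [<-|Ht']; [lra|]. generalize (Hle t' Ht'). lra.
      + exists v. split; [exact Hv|].
        intros t' [<-|Ht']; [lra|]. exact (Hle t' Ht'). }
  destruct Hv as (v & Hv & Hle).
  destruct (Hl (fst v, (snd v, tt))) as ([x [y []]] & Ht & _ & Hclose).
  { generalize (Rmax_Cmod v). intros Hm.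
    assert (H1 := Rle_trans _ _ _ (Rmax_l _ _) Hm).
    assert (H2 := Rle_trans _ _ _ (Rmax_r _ _) Hm).
    assert (H3 := Rle_trans _ _ _ H1 Hv). assert (H4 := Rle_trans _ _ _ H2 Hv).
    apply Rabs_le_between in H3. apply Rabs_le_between in H4.
    simpl. repeat split; lra. }
  simpl in Hclose. destruct Hclose as (H1 & H2 & _).
  destruct (Hq (x, (y, tt))) as [_ Hlt]. simpl in Hlt.
  assert (Hvlt := Hlt v Hv).
  specialize (Hle _ Ht). apply (Rlt_irrefl (u v)).
  apply Rlt_le_trans with (2 := Hle). apply Hvlt.
  apply Rle_lt_trans with (1 := Cmod_le_Rabs _).
  change (fst (v - (x, y))%C) with (fst v - x). change (snd (v - (x, y))%C) with (snd v - y).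
  lra.
Qed.

(** A second-order expansion with cubic remainder: all the regularity that the
    maximum principle uses, and stable under division by [z] away from [0]. *)
Definition has_jet (g : C -> C) (z : C) : Prop :=
  exists (b0 b1 b2 : C) (K d : R), 0 <= K /\ 0 < d /\
    forall w, Cmod w < d ->
      Cmod (g (z + w) - (b0 + b1 * w + b2 * w ^ 2))%C <= K * Cmod w ^ 3.

(** The linear and quadratic terms cancel in the sum over the four points, because
    [1, -1, i, -i] as well as their squares sum to zero; the squared moduli of
    these terms only increase the sum. *)
Lemma four_point_sum (b0 b1 b2 : C) (t : R) :
  let p := fun w : C => (b0 + b1 * w + b2 * w ^ 2)%C in
  4 * Cmod b0 ^ 2 <= Cmod (p (RtoC t)) ^ 2 + Cmod (p (RtoC (- t))) ^ 2
    + Cmod (p (Ci * RtoC t)%C) ^ 2 + Cmod (p (Ci * RtoC (- t))%C) ^ 2.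
Proof.
  intros p. unfold p. rewrite !Cmod2_alt.
  destruct b0 as [x0 y0], b1 as [x1 y1], b2 as [x2 y2].
  unfold Re, Im, Cplus, Cmult, Ci, RtoC; simpl.
  match goal with |- ?L <= ?X => replace X with
    (L + (4 * (x1 ^ 2 + y1 ^ 2) * t ^ 2 + 4 * (x2 ^ 2 + y2 ^ 2) * t ^ 4)) by ring end.
  assert (0 <= 4 * (x1 ^ 2 + y1 ^ 2) * t ^ 2).
  { apply Rmult_le_pos; [|apply pow2_ge_0]. generalize (pow2_ge_0 x1) (pow2_ge_0 y1). lra. }
  assert (0 <= 4 * (x2 ^ 2 + y2 ^ 2) * t ^ 4).
  { apply Rmult_le_pos; [generalize (pow2_ge_0 x2) (pow2_ge_0 y2); lra|].
    replace (t ^ 4) with ((t ^ 2) ^ 2) by ring. apply pow2_ge_0. }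
  lra.
Qed.

Lemma has_jet_center (g : C -> C) (z b0 b1 b2 : C) (K d : R) :
  0 < d ->
  (forall w, Cmod w < d ->
      Cmod (g (z + w) - (b0 + b1 * w + b2 * w ^ 2))%C <= K * Cmod w ^ 3) ->
  g z = b0.
Proof.
  intros Hd H. specialize (H (RtoC 0)). rewrite Cmod_0 in H. specialize (H Hd).
  replace (g (z + 0) - (b0 + b1 * 0 + b2 * 0 ^ 2))%C with (g z - b0)%C in H
    by (replace (z + 0)%C with z by ring; ring).
  replace (K * 0 ^ 3) with 0 in H by ring.
  assert (Z := Cmod_eq_0 _ (Rle_antisym _ _ H (Cmod_ge_0 _))).
  replace (g z) with (g z - b0 + b0)%C by ring. rewrite Z. ring.
Qed.

Lemma Cmod_quadratic_le (b1 b2 w : C) :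
  Cmod w <= 1 ->
  Cmod (b1 * w + b2 * w ^ 2)%C <= (Cmod b1 + Cmod b2) * Cmod w.
Proof.
  intros Hw. apply Rle_trans with (1 := Cmod_triangle _ _).
  rewrite !Cmod_mult, Cmod_pow. rewrite Rmult_plus_distr_r.
  apply Rplus_le_compat_l, Rmult_le_compat_l; [apply Cmod_ge_0|].
  simpl. rewrite Rmult_1_r. rewrite <- (Rmult_1_r (Cmod w)) at 3.
  apply Rmult_le_compat_l; [apply Cmod_ge_0 | exact Hw].
Qed.

Lemma has_jet_continuous (g : C -> C) (z : C) :
  has_jet g z -> forall eps, 0 < eps -> exists d, 0 < d /\
    forall w, Cmod w < d -> Cmod (g (z + w) - g z)%C < eps.
Proof.
  intros (b0 & b1 & b2 & K & d & HK & Hd & H) eps Heps.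
  assert (E := has_jet_center g z b0 b1 b2 K d Hd H).
  assert (H1 := Cmod_ge_0 b1). assert (H2 := Cmod_ge_0 b2).
  set (L := Cmod b1 + Cmod b2 + K + 1). assert (HL : 0 < L) by (unfold L; lra).
  exists (Rmin (Rmin d 1) (eps / L)). split.
  { repeat apply Rmin_pos; try lra. apply Rdiv_lt_0_compat; lra. }
  intros w Hw.
  assert (Hwd : Cmod w < d) by (apply Rlt_le_trans with (1 := Hw);
    apply Rle_trans with (1 := Rmin_l _ _), Rmin_l).
  assert (Hw1 : Cmod w < 1) by (apply Rlt_le_trans with (1 := Hw);
    apply Rle_trans with (1 := Rmin_l _ _), Rmin_r).
  assert (Hwe : Cmod w < eps / L) by (apply Rlt_le_trans with (1 := Hw), Rmin_r).
  assert (Hw0 := Cmod_ge_0 w).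
  replace (g (z + w) - g z)%C
    with ((g (z + w) - (b0 + b1 * w + b2 * w ^ 2)) + (b1 * w + b2 * w ^ 2))%C
    by (rewrite E; ring).
  apply Rle_lt_trans with (1 := Cmod_triangle _ _).
  assert (Hq := Cmod_quadratic_le b1 b2 w (Rlt_le _ _ Hw1)).
  specialize (H w Hwd).
  assert (H3 : K * Cmod w ^ 3 <= K * Cmod w).
  { apply Rmult_le_compat_l; [exact HK|]. simpl. rewrite Rmult_1_r.
    rewrite <- (Rmult_1_r (Cmod w)) at 4.
    apply Rmult_le_compat_l; [exact Hw0|].
    apply Rle_trans with (1 * 1); [|lra]. apply Rmult_le_compat; lra. }
  assert (H4 : Cmod w * L < eps).
  { apply Rmult_lt_reg_r with (/ L); [apply Rinv_0_lt_compat, HL|].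
    rewrite Rmult_assoc, Rinv_r, Rmult_1_r by lra. exact Hwe. }
  unfold L in H4. lra.
Qed.

Lemma Cmod_sqr_diff_le (x y : C) :
  Cmod (x - y) < 1 ->
  Rabs (Cmod x ^ 2 - Cmod y ^ 2) <= Cmod (x - y) * (2 * Cmod y + 1).
Proof.
  intros Hxy.
  assert (T1 := Cmod_triangle (x - y) y). assert (T2 := Cmod_triangle (y - x) x).
  replace (x - y + y)%C with x in T1 by ring. replace (y - x + x)%C with y in T2 by ring.
  rewrite <- (Cmod_opp (y - x)), Copp_minus_distr in T2.
  replace (Cmod x ^ 2 - Cmod y ^ 2) with ((Cmod x - Cmod y) * (Cmod x + Cmod y)) by ring.
  rewrite Rabs_mult. assert (C1 := Cmod_ge_0 x). assert (C2 := Cmod_ge_0 y).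
  apply Rmult_le_compat; try apply Rabs_pos.
  - apply Rabs_le_between. lra.
  - rewrite Rabs_pos_eq; lra.
Qed.

Lemma penalized_continuous (g : C -> C) (e : R) (z : C) :
  0 < e -> has_jet g z ->
  eps_continuous_at (fun x => Cmod (g x) ^ 2 + e * Cmod x ^ 2) z.
Proof.
  intros He Hg eps Heps.
  set (G := 2 * Cmod (g z) + 1). set (Z := e * (2 * Cmod z + 1)).
  assert (HG0 := Cmod_ge_0 (g z)). assert (HZ0 := Cmod_ge_0 z).
  assert (HG : 0 < G) by (unfold G; lra).
  assert (HZ : 0 < Z) by (unfold Z; apply Rmult_lt_0_compat; lra).
  destruct (has_jet_continuous g z Hg (Rmin 1 (eps / (2 * G)))) as (d & Hd & Hc).
  { apply Rmin_pos; [lra|]. apply Rdiv_lt_0_compat; lra. }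
  exists (Rmin d (Rmin 1 (eps / (2 * Z)))). split.
  { repeat apply Rmin_pos; try lra. apply Rdiv_lt_0_compat; lra. }
  intros w Hw.
  assert (Hwd := Rlt_le_trans _ _ _ Hw (Rmin_l _ _)).
  assert (Hw' := Rlt_le_trans _ _ _ Hw (Rmin_r _ _)).
  assert (Hw1 := Rlt_le_trans _ _ _ Hw' (Rmin_l _ _)).
  assert (HwZ := Rlt_le_trans _ _ _ Hw' (Rmin_r _ _)).
  specialize (Hc _ Hwd). replace (z + (w - z))%C with w in Hc by ring.
  assert (Hc1 := Rlt_le_trans _ _ _ Hc (Rmin_l _ _)).
  assert (HcG := Rlt_le_trans _ _ _ Hc (Rmin_r _ _)).
  assert (S1 := Cmod_sqr_diff_le _ _ Hc1). assert (S2 := Cmod_sqr_diff_le _ _ Hw1).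
  fold G in S1.
  assert (S3 : Cmod (g w - g z) * G < eps / 2).
  { apply Rmult_lt_reg_r with (/ G); [apply Rinv_0_lt_compat, HG|].
    rewrite Rmult_assoc, Rinv_r, Rmult_1_r by lra.
    replace (eps / 2 * / G) with (eps / (2 * G)) by (field; lra). exact HcG. }
  assert (S4 : Cmod (w - z) * Z < eps / 2).
  { apply Rmult_lt_reg_r with (/ Z); [apply Rinv_0_lt_compat, HZ|].
    rewrite Rmult_assoc, Rinv_r, Rmult_1_r by lra.
    replace (eps / 2 * / Z) with (eps / (2 * Z)) by (field; lra). exact HwZ. }
  replace (Cmod (g w) ^ 2 + e * Cmod w ^ 2 - (Cmod (g z) ^ 2 + e * Cmod z ^ 2))
    with ((Cmod (g w) ^ 2 - Cmod (g z) ^ 2) + e * (Cmod w ^ 2 - Cmod z ^ 2)) by ring.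
  apply Rle_lt_trans with (1 := Rabs_triang _ _).
  rewrite Rabs_mult, (Rabs_pos_eq e) by lra.
  assert (S5 := Rmult_le_compat_l e _ _ (Rlt_le _ _ He) S2).
  unfold Z in S4. lra.
Qed.

(** At distance [t] the mean of [|g|^2] over the four points can drop by [O(t^3)]
    only, whereas the penalty gains [e t^2]. *)
Lemma penalized_no_interior_max (g : C -> C) (e : R) (z0 : C) (r : R) :
  0 < e -> has_jet g z0 -> Cmod z0 < r ->
  ~ (forall w, Cmod w <= r ->
       Cmod (g w) ^ 2 + e * Cmod w ^ 2 <= Cmod (g z0) ^ 2 + e * Cmod z0 ^ 2).
Proof.
  intros He Hjet Hin Hmax.
  set (u := fun z => Cmod (g z) ^ 2 + e * Cmod z ^ 2) in *.
  destruct Hjet as (b0 & b1 & b2 & K & d & HK & Hd & Hj).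
  assert (E := has_jet_center g z0 b0 b1 b2 K d Hd Hj).
  set (p := fun w : C => (b0 + b1 * w + b2 * w ^ 2)%C) in *.
  assert (B0 := Cmod_ge_0 b0). assert (B1 := Cmod_ge_0 b1). assert (B2 := Cmod_ge_0 b2).
  (* [Q t^3] bounds the loss in [|g|^2] at each point: replacing [g] by its quadratic
     part [p] costs at most [2 |p| K t^3]. *)
  set (Q := 2 * K * (Cmod b0 + Cmod b1 + Cmod b2) + 1).
  assert (HQ : 0 < Q).
  { unfold Q. assert (0 <= 2 * K * (Cmod b0 + Cmod b1 + Cmod b2)); [|lra].
    apply Rmult_le_pos; lra. }
  set (t := Rmin (Rmin (d / 2) 1) (Rmin (r - Cmod z0) (e / (2 * Q)))).
  assert (Ht : 0 < t).
  { unfold t. repeat apply Rmin_pos; try lra. apply Rdiv_lt_0_compat; lra. }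
  assert (Htd : t < d).
  { assert (t <= d / 2); [|lra]. unfold t.
    apply Rle_trans with (1 := Rmin_l _ _), Rmin_l. }
  assert (Ht1 : t <= 1) by (unfold t; apply Rle_trans with (1 := Rmin_l _ _), Rmin_r).
  assert (Htr : t <= r - Cmod z0) by (unfold t; apply Rle_trans with (1 := Rmin_r _ _), Rmin_l).
  assert (Hte : t * Q < e).
  { assert (H : t <= e / (2 * Q)) by (unfold t; apply Rle_trans with (1 := Rmin_r _ _), Rmin_r).
    apply Rle_lt_trans with (e / (2 * Q) * Q); [apply Rmult_le_compat_r; lra|].
    replace (e / (2 * Q) * Q) with (e / 2) by (field; lra). lra. }
  assert (Hpt : forall w, Cmod w = t ->
    Cmod (p w) ^ 2 + e * Cmod (z0 + w) ^ 2 - Q * t ^ 3 <= u z0).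
  { intros w Hw.
    assert (Hzw : Cmod (z0 + w) <= r).
    { apply Rle_trans with (1 := Cmod_triangle _ _). lra. }
    apply Rle_trans with (2 := Hmax _ Hzw).
    assert (Hjw := Hj w). rewrite Hw in Hjw. specialize (Hjw Htd). fold (p w) in Hjw.
    assert (Hpw : Cmod (p w) <= Cmod b0 + Cmod b1 + Cmod b2).
    { unfold p. replace (b0 + b1 * w + b2 * w ^ 2)%C with (b0 + (b1 * w + b2 * w ^ 2))%C by ring.
      apply Rle_trans with (1 := Cmod_triangle _ _).
      assert (H := Cmod_quadratic_le b1 b2 w). rewrite Hw in H. specialize (H Ht1).
      assert ((Cmod b1 + Cmod b2) * t <= (Cmod b1 + Cmod b2) * 1); [|lra].
      apply Rmult_le_compat_l; lra. }
    assert (T := Cmod_triangle (p w - g (z0 + w))%C (g (z0 + w)%C)).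
    replace (p w - g (z0 + w) + g (z0 + w))%C with (p w) in T by ring.
    rewrite <- (Cmod_opp (p w - _)), Copp_minus_distr in T.
    assert (P0 := Cmod_ge_0 (p w)). assert (G0 := Cmod_ge_0 (g (z0 + w)%C)).
    assert (T3 : 0 < t ^ 3) by (apply pow_lt, Ht).
    assert (Hsq : Cmod (p w) ^ 2 - 2 * K * t ^ 3 * Cmod (p w) <= Cmod (g (z0 + w)%C) ^ 2).
    { destruct (Rle_lt_dec (Cmod (p w)) (K * t ^ 3)) as [H|H].
      - assert (0 <= Cmod (g (z0 + w)%C) ^ 2) by apply pow2_ge_0.
        assert (0 <= K * t ^ 3 * Cmod (p w)) by (apply Rmult_le_pos; lra).
        assert (Cmod (p w) * Cmod (p w) <= K * t ^ 3 * Cmod (p w))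
          by (apply Rmult_le_compat_r; lra).
        simpl pow at 1. lra.
      - assert (H2 : (Cmod (p w) - K * t ^ 3) ^ 2 <= Cmod (g (z0 + w)%C) ^ 2)
          by (apply pow_incr; lra).
        assert (0 <= (K * t ^ 3) ^ 2) by apply pow2_ge_0. lra. }
    assert (H2 : 2 * K * t ^ 3 * Cmod (p w)
      <= 2 * K * t ^ 3 * (Cmod b0 + Cmod b1 + Cmod b2)).
    { apply Rmult_le_compat_l; [|exact Hpw].
      apply Rmult_le_pos; [lra|]. lra. }
    unfold Q. lra. }
  assert (F := four_point_sum b0 b1 b2 t). cbv zeta in F. fold p in F.
  assert (C1 : Cmod (RtoC t) = t) by (rewrite Cmod_R; apply Rabs_pos_eq; lra).
  assert (C2 : Cmod (RtoC (- t)) = t) by (rewrite Cmod_R, Rabs_Ropp; apply Rabs_pos_eq; lra).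
  assert (C3 : Cmod (Ci * RtoC t) = t) by (rewrite Cmod_mult, Cmod_Ci, C1; ring).
  assert (C4 : Cmod (Ci * RtoC (- t)) = t) by (rewrite Cmod_mult, Cmod_Ci, C2; ring).
  assert (N : Cmod (z0 + RtoC t) ^ 2 + Cmod (z0 + RtoC (- t)) ^ 2
    + Cmod (z0 + Ci * RtoC t) ^ 2 + Cmod (z0 + Ci * RtoC (- t)) ^ 2
    = 4 * Cmod z0 ^ 2 + 4 * t ^ 2).
  { rewrite !Cmod2_alt. destruct z0 as [x y].
    unfold Re, Im, Cplus, Cmult, Ci, RtoC; simpl. ring. }
  assert (P1 := Hpt _ C1). assert (P2 := Hpt _ C2).
  assert (P3 := Hpt _ C3). assert (P4 := Hpt _ C4).
  assert (U0 : u z0 = Cmod b0 ^ 2 + e * Cmod z0 ^ 2) by (unfold u; rewrite E; reflexivity).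
  assert (T2 : 0 < t ^ 2) by (apply pow_lt, Ht).
  assert (Hfin : Q * t ^ 3 < e * t ^ 2).
  { replace (Q * t ^ 3) with (t * Q * t ^ 2) by ring. apply Rmult_lt_compat_r; lra. }
  assert (N' := f_equal (Rmult e) N). lra.
Qed.

(** If [|g(z1)| > M], a small enough penalty [e] keeps the maximum of
    [|g|^2 + e |x|^2] off the circle, hence forces it into the interior. *)
Lemma max_principle (g : C -> C) (r M : R) :
  0 < r -> (forall z, Cmod z <= r -> has_jet g z) ->
  (forall z, Cmod z = r -> Cmod (g z) <= M) ->
  forall z, Cmod z <= r -> Cmod (g z) <= M.
Proof.
  intros Hr Hjet Hbd z1 Hz1.
  destruct (Rle_lt_dec (Cmod (g z1)) M) as [Hle|Hlt]; [exact Hle|exfalso].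
  assert (HM : 0 <= M).
  { apply Rle_trans with (2 := Hbd (RtoC r)
      (eq_trans (Cmod_R r) (Rabs_pos_eq r (Rlt_le _ _ Hr)))). apply Cmod_ge_0. }
  assert (HM2 : M ^ 2 < Cmod (g z1) ^ 2) by (simpl; rewrite !Rmult_1_r;
    apply Rmult_le_0_lt_compat; lra).
  set (e := (Cmod (g z1) ^ 2 - M ^ 2) / (2 * r ^ 2)).
  assert (Hr2 : 0 < r ^ 2) by (apply pow_lt, Hr).
  assert (He : 0 < e) by (apply Rdiv_lt_0_compat; lra).
  assert (Her : 2 * (e * r ^ 2) = Cmod (g z1) ^ 2 - M ^ 2) by (unfold e; field; lra).
  set (u := fun z => Cmod (g z) ^ 2 + e * Cmod z ^ 2).
  destruct (closed_disk_max u r (Rlt_le _ _ Hr)) as (z0 & Hz0 & Hmax).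
  { intros z Hz. apply penalized_continuous; [exact He | exact (Hjet z Hz)]. }
  assert (Hu1 := Hmax z1 Hz1).
  assert (Hu1' : Cmod (g z1) ^ 2 <= u z1).
  { unfold u. assert (0 <= e * Cmod z1 ^ 2); [|lra].
    apply Rmult_le_pos; [lra | apply pow2_ge_0]. }
  destruct (Rle_lt_or_eq_dec _ _ Hz0) as [Hin|Hon].
  2:{ assert (Hu0 : u z0 <= M ^ 2 + e * r ^ 2).
      { unfold u. rewrite Hon. apply Rplus_le_compat_r.
        apply pow_incr. split; [apply Cmod_ge_0 | apply Hbd, Hon]. }
      lra. }
  exact (penalized_no_interior_max g e z0 r He (Hjet z0 Hz0) Hin Hmax).
Qed.

(** * The Schwarz lemma *)

(** When [h] vanishes at the origin, the right choice of [s] removes the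
    singularity of [h(z) / z] there. *)
Definition slope (h : C -> C) (s z : C) : C :=
  if Ceq_dec z (RtoC 0) then s else (h z / z)%C.

Lemma slope_jet_0 (h : C -> C) :
  analytic_at h (RtoC 0) -> h (RtoC 0) = RtoC 0 -> exists s, has_jet (slope h s) (RtoC 0).
Proof.
  intros Hh H0.
  destruct (analytic_at_expand h (RtoC 0) 4 Hh) as (a & K & d & HK & Hd & Ea & H).
  exists (a 1%nat), (a 1%nat), (a 2%nat), (a 3%nat), K, d.
  split; [lra|]. split; [exact Hd|]. intros w Hw.
  specialize (H w Hw). simpl partial_sum in H. rewrite <- Ea, H0 in H.
  replace (0 + w)%C with w in * by ring. unfold slope.
  destruct (Ceq_dec w (RtoC 0)) as [E|E].
  - rewrite E. replace (a 1%nat - (a 1%nat + a 2%nat * 0 + a 3%nat * 0 ^ 2))%C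
      with (RtoC 0) by ring. rewrite Cmod_0. apply Req_le. ring.
  - assert (Hw0 : 0 < Cmod w) by (apply Cmod_gt_0, E).
    apply Rmult_le_reg_r with (Cmod w); [exact Hw0|].
    rewrite <- Cmod_mult.
    replace (K * Cmod w ^ 3 * Cmod w) with (K * Cmod w ^ 4) by ring.
    replace ((h w / w - (a 1%nat + a 2%nat * w + a 3%nat * w ^ 2)) * w)%C
      with (h w - (0 + 0 * 1 + a 1%nat * (w * 1) + a 2%nat * (w * (w * 1))
            + a 3%nat * (w * (w * (w * 1)))))%C by (field; exact E).
    exact H.
Qed.

(** The coefficients [b] solve [(z0 + w) (b0 + b1 w + b2 w^2) = a0 + a1 w + a2 w^2]
    up to the term [b2 w^3], which joins the cubic remainder. *)
Lemma slope_jet_neq0 (h : C -> C) (s z0 : C) :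
  z0 <> RtoC 0 -> analytic_at h z0 -> has_jet (slope h s) z0.
Proof.
  intros Hz0 Hh.
  destruct (analytic_at_expand h z0 3 Hh) as (a & K & d & HK & Hd & _ & H).
  set (b0 := (a 0%nat / z0)%C). set (b1 := ((a 1%nat - b0) / z0)%C).
  set (b2 := ((a 2%nat - b1) / z0)%C).
  assert (Hm : 0 < Cmod z0) by (apply Cmod_gt_0, Hz0).
  assert (HB := Cmod_ge_0 b2).
  exists b0, b1, b2, ((K + Cmod b2) * (2 / Cmod z0)), (Rmin d (Cmod z0 / 2)).
  split.
  { apply Rmult_le_pos; [lra|]. apply Rlt_le, Rdiv_lt_0_compat; lra. }
  split; [apply Rmin_pos; lra|]. intros w Hw.
  assert (Hwd := Rlt_le_trans _ _ _ Hw (Rmin_l _ _)).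
  assert (Hw2 := Rlt_le_trans _ _ _ Hw (Rmin_r _ _)).
  specialize (H w Hwd). simpl partial_sum in H.
  assert (Hzw : Cmod z0 / 2 <= Cmod (z0 + w)).
  { assert (T := Cmod_triangle (z0 + w) (- w)).
    replace (z0 + w + - w)%C with z0 in T by ring. rewrite Cmod_opp in T. lra. }
  assert (Hne : (z0 + w)%C <> RtoC 0) by (apply Cmod_gt_0; lra).
  unfold slope. destruct (Ceq_dec (z0 + w) (RtoC 0)) as [E|_]; [contradiction|].
  assert (Hw0 := Cmod_ge_0 w).
  assert (Hw3 : 0 <= Cmod w ^ 3) by (apply pow_le, Hw0).
  apply Rmult_le_reg_r with (Cmod (z0 + w)); [lra|].
  rewrite <- Cmod_mult.
  replace ((h (z0 + w) / (z0 + w) - (b0 + b1 * w + b2 * w ^ 2)) * (z0 + w))%C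
    with ((h (z0 + w) - (0 + a 0%nat * 1 + a 1%nat * (w * 1) + a 2%nat * (w * (w * 1))))
          + - (b2 * w ^ 3))%C.
  2:{ assert (E0 : a 0%nat = (b0 * z0)%C) by (unfold b0; field; exact Hz0).
      assert (E1 : a 1%nat = (b1 * z0 + b0)%C) by (unfold b1; field; exact Hz0).
      assert (E2 : a 2%nat = (b2 * z0 + b1)%C) by (unfold b2; field; exact Hz0).
      rewrite E0, E1, E2. clearbody b0 b1 b2. field. exact Hne. }
  apply Rle_trans with (1 := Cmod_triangle _ _).
  rewrite Cmod_opp, Cmod_mult, Cmod_pow.
  apply Rle_trans with ((K + Cmod b2) * Cmod w ^ 3); [lra|].
  apply Rle_trans with ((K + Cmod b2) * (2 / Cmod z0) * Cmod w ^ 3 * (Cmod z0 / 2)).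
  - apply Req_le. field. lra.
  - apply Rmult_le_compat_l; [|exact Hzw].
    repeat apply Rmult_le_pos; try lra. apply Rlt_le, Rinv_0_lt_compat, Hm.
Qed.

(** On the circle of radius [r < 1] the quotient is at most [1 / r], hence also
    inside.  If [|h(z)| > |z|], then [q = |z| / |h(z)| < 1], and any [r] strictly
    between [q] and [1] contradicts this bound at [z]. *)
Lemma Schwarz_lemma (h : C -> C) :
  analytic_on_disk h -> (forall z, unit_disk z -> unit_disk (h z)) ->
  h (RtoC 0) = RtoC 0 -> forall z, unit_disk z -> Cmod (h z) <= Cmod z.
Proof.
  unfold unit_disk. intros Hh Hb H0 z Hz.
  destruct (Rle_lt_dec (Cmod (h z)) (Cmod z)) as [Hle|Hlt]; [exact Hle|exfalso].
  assert (D0 : unit_disk (RtoC 0)) by (unfold unit_disk; rewrite Cmod_0; lra).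
  destruct (slope_jet_0 h (Hh _ D0) H0) as [s Hs].
  assert (Hz0 : z <> RtoC 0).
  { intros E. rewrite E, H0 in Hlt. lra. }
  assert (Hzp : 0 < Cmod z) by (apply Cmod_gt_0, Hz0).
  assert (Hhz := Hb z Hz).
  set (q := Cmod z / Cmod (h z)).
  assert (Eq : q * Cmod (h z) = Cmod z) by (unfold q; field; lra).
  assert (Hq : Cmod z < q /\ q < 1).
  { split; apply Rmult_lt_reg_r with (Cmod (h z)); try lra; rewrite Eq.
    rewrite <- (Rmult_1_r (Cmod z)) at 2. apply Rmult_lt_compat_l; lra. }
  set (r := (1 + q) / 2). assert (Hr : q < r < 1) by (unfold r; lra).
  assert (Hmax : Cmod (slope h s z) <= / r).
  { apply max_principle with r; try lra.
    - intros x Hx. destruct (Ceq_dec x (RtoC 0)) as [E|E].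
      + rewrite E. exact Hs.
      + apply slope_jet_neq0; [exact E|]. apply Hh. unfold unit_disk. lra.
    - intros x Hx. assert (Hx0 : x <> RtoC 0) by (apply Cmod_gt_0; lra).
      unfold slope. destruct (Ceq_dec x (RtoC 0)) as [E|_]; [contradiction|].
      rewrite Cmod_div by exact Hx0. rewrite Hx.
      assert (Hhx : Cmod (h x) < 1) by (apply Hb; lra).
      unfold Rdiv. rewrite <- (Rmult_1_l (/ r)) at 2.
      apply Rmult_le_compat_r; [|lra]. apply Rlt_le, Rinv_0_lt_compat; lra. }
  unfold slope in Hmax. destruct (Ceq_dec z (RtoC 0)) as [E|_]; [contradiction|].
  rewrite Cmod_div in Hmax by exact Hz0.
  apply Rmult_le_compat_r with (r := r * Cmod z) in Hmax; [|apply Rmult_le_pos; lra].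
  replace (/ r * (r * Cmod z)) with (Cmod z) in Hmax by (field; lra).
  replace (Cmod (h z) / Cmod z * (r * Cmod z)) with (r * Cmod (h z)) in Hmax by (field; lra).
  assert (q * Cmod (h z) < r * Cmod (h z)) by (apply Rmult_lt_compat_r; lra).
  lra.
Qed.

(** * The lower bound for the pole *)

Lemma Cmod_RtoC_nonneg (x : R) : 0 <= x -> Cmod (RtoC x) = x.
Proof. intros Hx. rewrite Cmod_R. apply Rabs_pos_eq, Hx. Qed.



Lemma one_plus_mul_lower (B : R) (w : C) :
  -1 <= B <= 1 -> 1 - Cmod w <= Cmod (1 + B * w).
Proof.
  intros HB. assert (T := Cmod_triangle (1 + B * w) (- (B * w))).
  replace (1 + B * w + - (B * w))%C with (RtoC 1) in T by ring.
  rewrite Cmod_1, Cmod_opp, Cmod_mult, Cmod_R in T.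
  assert (Rabs B * Cmod w <= 1 * Cmod w); [|lra].
  apply Rmult_le_compat_r; [apply Cmod_ge_0 | apply Rabs_le_between; lra].
Qed.

Lemma one_plus_mul_neq_0 (B : R) (w : C) :
  -1 <= B <= 1 -> Cmod w < 1 -> (1 + B * w)%C <> RtoC 0.
Proof.
  intros HB Hw. apply Cmod_gt_0. generalize (one_plus_mul_lower B w HB). lra.
Qed.

Lemma pre_schwarzian_eq (A B : R) (z q h : C) :
  (1 + B * h)%C <> RtoC 0 ->
  (1 + z * q = (1 + A * h) / (1 + B * h))%C ->
  (z * q * (1 + B * h) = (A - B)%R * h)%C.
Proof.
  intros Hn E.
  replace (z * q)%C with (1 + z * q - 1)%C by ring. rewrite E, RtoC_minus.
  field. exact Hn.
Qed.

(** For small [t > 0], cancelling [t] in the identity of [pre_schwarzian_eq] and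
    using [|h(t)| <= t] gives [|f''(t)| (1 - t) <= (A - B) |f'(t)|]; let [t -> 0]. *)
Lemma pre_schwarzian_at_0 (A B : R) (f : C -> C) :
  -1 <= B -> B < A -> A <= 1 -> janowski A B f ->
  Cmod (d2 f (RtoC 0)) <= (A - B) * Cmod (d1 f (RtoC 0)).
Proof.
  intros hB hBA hA (Hf & Hf1 & h & Hh & Hhb & Hh0 & Hsub).
  assert (D0 : unit_disk (RtoC 0)) by (unfold unit_disk; rewrite Cmod_0; lra).
  assert (A1 : analytic_at (d1 f) (RtoC 0)) by (apply analytic_at_C_derive, Hf, D0).
  assert (A2 : analytic_at (d2 f) (RtoC 0)) by (apply analytic_at_C_derive, A1).
  set (X := Cmod (d2 f (RtoC 0))). set (Y := Cmod (d1 f (RtoC 0))).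
  apply le_epsilon. intros e He.
  destruct (analytic_at_continuous _ _ A1 (e / 4)) as (s1 & Hs1 & H1); [lra|].
  destruct (analytic_at_continuous _ _ A2 (e / 4)) as (s2 & Hs2 & H2); [lra|].
  assert (HX : 0 <= X) by apply Cmod_ge_0.
  assert (Heq : 0 < e / (8 * (X + 1))) by (apply Rdiv_lt_0_compat; lra).
  set (t := Rmin (Rmin (s1 / 2) (s2 / 2)) (Rmin (/ 2) (e / (8 * (X + 1))))).
  assert (Ht : 0 < t) by (unfold t; repeat apply Rmin_pos; lra).
  assert (Ht1 : t < s1).
  { assert (t <= s1 / 2); [|lra]. unfold t. apply Rle_trans with (1 := Rmin_l _ _), Rmin_l. }
  assert (Ht2 : t < s2).
  { assert (t <= s2 / 2); [|lra]. unfold t. apply Rle_trans with (1 := Rmin_l _ _), Rmin_r. }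
  assert (Ht3 : t <= / 2) by (unfold t; apply Rle_trans with (1 := Rmin_r _ _), Rmin_l).
  assert (Ht4 : t * X <= e / 8).
  { assert (H : t <= e / (8 * (X + 1))) by (unfold t; apply Rle_trans with (1 := Rmin_r _ _), Rmin_r).
    apply Rle_trans with (e / (8 * (X + 1)) * (X + 1)).
    - apply Rmult_le_compat; lra.
    - apply Req_le. field. lra. }
  assert (Mt : Cmod (RtoC t) = t) by (apply Cmod_RtoC_nonneg; lra).
  specialize (H1 (RtoC t)). specialize (H2 (RtoC t)). rewrite Mt in H1, H2.
  specialize (H1 Ht1). specialize (H2 Ht2).
  replace (0 + t)%C with (RtoC t) in H1, H2 by ring.
  assert (Dt : unit_disk (RtoC t)) by (unfold unit_disk; lra).
  assert (St := Schwarz_lemma h Hh Hhb Hh0 _ Dt). rewrite Mt in St.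
  assert (Hht := Hhb _ Dt). unfold unit_disk in Hht.
  assert (Hn := one_plus_mul_neq_0 B (h (RtoC t)) ltac:(lra) Hht).
  assert (E := pre_schwarzian_eq A B _ _ _ Hn (Hsub _ Dt)).
  assert (F1 := Hf1 _ Dt).
  assert (E' : (RtoC t * d2 f t * (1 + B * h t) = (A - B)%R * h t * d1 f t)%C).
  { rewrite <- E. field. exact F1. }
  apply (f_equal Cmod) in E'. rewrite !Cmod_mult, Mt, Cmod_RtoC_nonneg in E' by lra.
  assert (L := one_plus_mul_lower B (h (RtoC t)) ltac:(lra)).
  assert (C2 := Cmod_ge_0 (d2 f t)). assert (C1 := Cmod_ge_0 (d1 f t)).
  assert (K1 : t * Cmod (d2 f t) * (1 - t) <= (A - B) * t * Cmod (d1 f t)).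
  { apply Rle_trans with (t * Cmod (d2 f t) * Cmod (1 + B * h t)).
    - apply Rmult_le_compat_l; [apply Rmult_le_pos; lra | lra].
    - rewrite E'. apply Rmult_le_compat_r; [exact C1|].
      apply Rmult_le_compat_l; lra. }
  assert (K2 : Cmod (d2 f t) * (1 - t) <= (A - B) * Cmod (d1 f t)).
  { apply Rmult_le_reg_l with t; [exact Ht|]. lra. }
  assert (T2 := Cmod_triangle (d2 f t) (- (d2 f t - d2 f (RtoC 0)))).
  replace (d2 f t + - (d2 f t - d2 f (RtoC 0)))%C with (d2 f (RtoC 0)) in T2 by ring.
  rewrite Cmod_opp in T2. fold X in T2.
  assert (T1 := Cmod_triangle (d1 f t - d1 f (RtoC 0)) (d1 f (RtoC 0))).
  replace (d1 f t - d1 f (RtoC 0) + d1 f (RtoC 0))%C with (d1 f t) in T1 by ring.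
  fold Y in T1.
  assert (K3 : (X - e / 4) * (1 - t) <= Cmod (d2 f t) * (1 - t)).
  { apply Rmult_le_compat_r; lra. }
  assert (K4 : (A - B) * Cmod (d1 f t) <= (A - B) * (Y + e / 4)).
  { apply Rmult_le_compat_l; lra. }
  assert (K5 : (A - B) * (e / 4) <= 2 * (e / 4)) by (apply Rmult_le_compat_r; lra).
  assert (K6 : 0 <= e / 4 * t) by (apply Rmult_le_pos; lra).
  lra.
Qed.

Lemma pole_lower_bound (A B : R) (f : C -> C) (z : C) :
  -1 <= B -> B < A -> A <= 1 -> janowski A B f -> unit_disk z ->
  Rbar_le (Finite (pole_bound A B z)) (ext_Cmod (pole f z)).
Proof.
  intros hB hBA hA Hj Hz. unfold pole.
  destruct (Ceq_dec (d2 f z) (RtoC 0)) as [E2|E2]; [exact I|].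
  simpl. unfold pole_bound.
  assert (H0 := pre_schwarzian_at_0 A B f hB hBA hA Hj).
  destruct Hj as (Hf & Hf1 & h & Hh & Hhb & Hh0 & Hsub).
  assert (F1 := Hf1 z Hz).
  assert (P1 : 0 < Cmod (d1 f z)) by (apply Cmod_gt_0, F1).
  assert (P2 : 0 < Cmod (d2 f z)) by (apply Cmod_gt_0, E2).
  assert (M2 : Cmod 2 = 2) by (apply Cmod_RtoC_nonneg; lra).
  destruct (Ceq_dec z (RtoC 0)) as [Ez|Ez].
  - subst z. rewrite Cmod_0, Rmult_0_r, Rminus_0_r.
    replace (0 + 2 * (d1 f 0 / d2 f 0))%C with (2 * (d1 f 0 / d2 f 0))%C by ring.
    rewrite Cmod_mult, Cmod_div, M2 by exact E2.
    unfold Rdiv. apply Rmult_le_compat_l; [lra|].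
    apply Rmult_le_reg_r with ((A - B) * Cmod (d2 f (RtoC 0))); [apply Rmult_lt_0_compat; lra|].
    replace (/ (A - B) * ((A - B) * Cmod (d2 f (RtoC 0)))) with (Cmod (d2 f (RtoC 0)))
      by (field; lra).
    replace (Cmod (d1 f (RtoC 0)) * / Cmod (d2 f (RtoC 0)) * ((A - B) * Cmod (d2 f (RtoC 0))))
      with ((A - B) * Cmod (d1 f (RtoC 0))) by (field; lra).
    exact H0.
  - assert (Hhz := Hhb _ Hz). unfold unit_disk in Hhz, Hz.
    assert (Hn := one_plus_mul_neq_0 B (h z) ltac:(lra) Hhz).
    assert (E := pre_schwarzian_eq A B _ _ _ Hn (Hsub _ Hz)).
    assert (Sz := Schwarz_lemma h Hh Hhb Hh0 z Hz).
    assert (Zp : 0 < Cmod z) by (apply Cmod_gt_0, Ez).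
    assert (Hne : RtoC (A - B) <> RtoC 0).
    { apply Cmod_gt_0. rewrite Cmod_RtoC_nonneg; lra. }
    assert (Hh1 : h z <> RtoC 0).
    { intros Eh. rewrite Eh in E, Hn.
      assert (Hp : (z * (d2 f z / d1 f z) * (1 + B * 0))%C <> RtoC 0).
      { apply Cmult_neq_0; [apply Cmult_neq_0; [exact Ez|]|exact Hn].
        apply Cmod_gt_0. rewrite Cmod_div by exact F1. apply Rdiv_lt_0_compat; assumption. }
      apply Hp. rewrite E. ring. }
    assert (Hp : 0 < Cmod (h z)) by (apply Cmod_gt_0, Hh1).
    assert (Eq : (d1 f z / d2 f z = z * (1 + B * h z) / ((A - B)%R * h z))%C).
    { rewrite <- E. field. repeat split; assumption. }
    rewrite Eq.
    replace (z + 2 * (z * (1 + B * h z) / ((A - B)%R * h z)))%C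
      with (z * (2 + (A + B)%R * h z) / ((A - B)%R * h z))%C.
    2:{ rewrite RtoC_plus. rewrite RtoC_minus in Hne |- *. field. split; assumption. }
    rewrite Cmod_div by (apply Cmult_neq_0; assumption).
    rewrite !Cmod_mult, (Cmod_RtoC_nonneg (A - B)) by lra.
    assert (T : 2 - Rabs (A + B) * Cmod (h z) <= Cmod (2 + (A + B)%R * h z)).
    { assert (T := Cmod_triangle (2 + (A + B)%R * h z) (- ((A + B)%R * h z))).
      replace (2 + (A + B)%R * h z + - ((A + B)%R * h z))%C with (RtoC 2) in T by ring.
      rewrite M2, Cmod_opp, Cmod_mult, Cmod_R in T. lra. }
    apply Rmult_le_reg_r with ((A - B) * Cmod (h z)); [apply Rmult_lt_0_compat; lra|].
    replace ((2 - Rabs (A + B) * Cmod z) / (A - B) * ((A - B) * Cmod (h z)))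
      with (2 * Cmod (h z) - Cmod z * (Rabs (A + B) * Cmod (h z))) by (field; lra).
    replace (Cmod z * Cmod (2 + (A + B)%R * h z) / ((A - B) * Cmod (h z)) * ((A - B) * Cmod (h z)))
      with (Cmod z * Cmod (2 + (A + B)%R * h z)) by (field; lra).
    apply Rle_trans with (Cmod z * (2 - Rabs (A + B) * Cmod (h z))).
    + lra.
    + apply Rmult_le_compat_l; lra.
Qed.

(** * Extremal functions *)

(** Bernoulli's inequality bounds [(n + 1) q^n] by a geometric sequence of ratio
    [q (1 + d) < 1]. *)
Lemma pseries_on_linear_growth (a : nat -> C) :
  (forall n, Cmod (a n) <= INR n + 1) -> exists F, pseries_on a F (RtoC 0) 1.
Proof.
  intros Ha.
  assert (Hex : forall w, exists s, Cmod (w - 0) < 1 -> is_pseriesC a (w - 0)%C s).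
  { intros w. destruct (Rlt_le_dec (Cmod (w - 0)) 1) as [Hw|Hw].
    2:{ exists (RtoC 0). intros H. exfalso. lra. }
    set (x := (w - 0)%C) in *. set (q := Cmod x) in *.
    assert (Hq : 0 <= q) by apply Cmod_ge_0.
    set (d := (1 - q) / 2). assert (Hd : 0 < d <= 1) by (unfold d; lra).
    assert (Hqd : 0 <= q * (1 + d) < 1).
    { split; [apply Rmult_le_pos; lra|]. unfold d.
      assert (0 < (1 - q) * (2 - q)) by (apply Rmult_lt_0_compat; lra). lra. }
    destruct (ex_seriesC_le (fun n => a n * x ^ n)%C (fun n => / d * (q * (1 + d)) ^ n))
      as [s Hs].
    - intros n. rewrite Cmod_mult, Cmod_pow. fold q. rewrite Rpow_mult_distr.
      replace (/ d * (q ^ n * (1 + d) ^ n)) with (/ d * (1 + d) ^ n * q ^ n) by ring.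
      apply Rmult_le_compat_r; [apply pow_le, Hq|].
      apply Rle_trans with (1 := Ha n).
      apply Rmult_le_reg_l with d; [lra|].
      rewrite <- Rmult_assoc, Rinv_r, Rmult_1_l by lra.
      generalize (poly n d (proj1 Hd)). lra.
    - apply (ex_series_scal_l (K := R_AbsRing) (V := R_NormedModule) (/ d)
        (fun n => (q * (1 + d)) ^ n)). apply ex_series_geom.
      rewrite Rabs_pos_eq; lra.
    - exists s. intros _. apply is_pseriesC_term. exact Hs. }
  exists (fun w => proj1_sig (constructive_indefinite_description _ (Hex w))).
  intros w. exact (proj2_sig (constructive_indefinite_description _ (Hex w))).
Qed.

(** Taylor coefficients at [0] of [(1 + B c w)^(l / B)], or of [exp (l c w)] when
    [B = 0]. *)
Fixpoint binomial_coef (c : C) (l B : R) (n : nat) : C :=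
  match n with
  | O => RtoC 1
  | S m => (c * ((l - B * INR m) / INR (S m))%R * binomial_coef c l B m)%C
  end.

Lemma binomial_coef_le (c : C) (l B : R) (n : nat) :
  Cmod c = 1 -> Rabs l <= 2 -> Rabs B <= 1 ->
  Cmod (binomial_coef c l B n) <= INR n + 1.
Proof.
  intros Hc Hl HB. induction n as [|n IH].
  - simpl. rewrite Cmod_1. lra.
  - change (binomial_coef c l B (S n))
      with (c * ((l - B * INR n) / INR (S n))%R * binomial_coef c l B n)%C.
    rewrite !Cmod_mult, Hc, Cmod_R, Rmult_1_l.
    assert (Hn := pos_INR n). rewrite !S_INR.
    assert (H : Rabs (l - B * INR n) <= 2 + INR n).
    { unfold Rminus. apply Rle_trans with (1 := Rabs_triang _ _).
      rewrite Rabs_Ropp, Rabs_mult, (Rabs_pos_eq (INR n)) by lra.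
      assert (Rabs B * INR n <= 1 * INR n) by (apply Rmult_le_compat_r; lra). lra. }
    unfold Rdiv. rewrite Rabs_mult, Rabs_inv, (Rabs_pos_eq (INR n + 1)) by lra.
    apply Rle_trans with ((2 + INR n) * / (INR n + 1) * (INR n + 1)).
    + apply Rmult_le_compat; try apply Cmod_ge_0; try lra.
      * apply Rmult_le_pos; [apply Rabs_pos|]. apply Rlt_le, Rinv_0_lt_compat; lra.
      * apply Rmult_le_compat_r; [|exact H]. apply Rlt_le, Rinv_0_lt_compat; lra.
    + apply Req_le. field. lra.
Qed.

(** The recurrence [(n + 1) a_(n+1) = c (l - B n) a_n] read as an identity between
    power series. *)
Lemma binomial_ode (c : C) (l B : R) (F : C -> C) (w : C) :
  pseries_on (binomial_coef c l B) F (RtoC 0) 1 -> Cmod w < 1 ->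
  ((1 + B * (c * w)) * C_derive F w = l * c * F w)%C.
Proof.
  intros HF Hw. set (a := binomial_coef c l B) in *.
  assert (E0 : (w - 0)%C = w) by ring.
  assert (HFw := HF w). assert (HDw := pseries_on_C_derive a F (RtoC 0) 1 HF w).
  rewrite E0 in HFw, HDw. specialize (HFw Hw). specialize (HDw Hw).
  assert (H1 := is_pseries_scal (K := C_AbsRing) (V := C_NormedModule) (l * c)%C a w _
    (Cmult_comm _ _) HFw).
  assert (H2 := is_pseries_incr_1 (K := C_AbsRing) (V := C_NormedModule) _ w _ HDw).
  assert (H3 := is_pseries_scal (K := C_AbsRing) (V := C_NormedModule) (B * c)%C _ w _
    (Cmult_comm _ _) H2).
  assert (H4 := is_pseries_plus (K := C_AbsRing) (V := C_NormedModule) _ _ w _ _ HDw H3).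
  transitivity (C_derive F w + B * c * (w * C_derive F w))%C; [ring|].
  apply (pseries_unique (PS_scal (K := C_AbsRing) (V := C_NormedModule) (l * c)%C a) w).
  2: exact H1.
  apply (is_pseries_ext (K := C_AbsRing) (V := C_NormedModule)) with (2 := H4).
  intros n.
  change ((PS_derivC a n + B * c * PS_incr_1 (PS_derivC a) n)%C = (l * c * a n)%C).
  assert (Ea : forall m, PS_derivC a m = (c * (l - B * INR m)%R * a m)%C).
  { intros m. unfold PS_derivC, a.
    change (binomial_coef c l B (S m))
      with (c * ((l - B * INR m) / INR (S m))%R * binomial_coef c l B m)%C.
    assert (Hm : INR (S m) <> 0) by (apply not_0_INR; lia).
    unfold Rdiv. rewrite RtoC_mult, RtoC_inv by exact Hm. field.
    intros E. apply Hm. apply RtoC_inj. exact E. }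
  rewrite Ea. destruct n as [|n].
  - change (PS_incr_1 (PS_derivC a) 0) with (RtoC 0). simpl INR.
    rewrite RtoC_minus, RtoC_mult. ring.
  - change (PS_incr_1 (PS_derivC a) (S n)) with (PS_derivC a n).
    unfold PS_derivC. rewrite RtoC_minus, RtoC_mult. ring.
Qed.

Lemma pseries_on_disk_derive (a : nat -> C) (F : C -> C) (w : C) :
  pseries_on a F (RtoC 0) 1 -> Cmod w < 1 ->
  @is_derive C_AbsRing C_NormedModule F w (C_derive F w).
Proof.
  intros HF Hw. apply (pseries_on_derive a F (RtoC 0) 1 w HF).
  replace (w - 0)%C with w by ring. exact Hw.
Qed.

(** The solutions for [l] and [- l] are reciprocal: the differential equations
    make the derivative of their product vanish. *)
Lemma binomial_neq_0 (c : C) (l B : R) (F : C -> C) (w : C) :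
  Cmod c = 1 -> Rabs l <= 2 -> Rabs B <= 1 ->
  pseries_on (binomial_coef c l B) F (RtoC 0) 1 -> Cmod w < 1 -> F w <> RtoC 0.
Proof.
  intros Hc Hl HB HF Hw.
  destruct (pseries_on_linear_growth (binomial_coef c (- l) B)) as [G HG].
  { intros n. apply binomial_coef_le; auto. rewrite Rabs_Ropp. exact Hl. }
  assert (HFG : (F w * G w)%C = (F (RtoC 0) * G (RtoC 0))%C).
  { apply (is_derive_C_zero_constant (fun x => F x * G x)%C (RtoC 0) 1).
    2:{ replace (w - 0)%C with w by ring. exact Hw. }
    intros x Hx. replace (x - 0)%C with x in Hx by ring.
    assert (D := is_derive_C_mult F G x _ _ (pseries_on_disk_derive _ F x HF Hx)
      (pseries_on_disk_derive _ G x HG Hx)).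
    assert (E1 := binomial_ode c l B F x HF Hx).
    assert (E2 := binomial_ode c (- l) B G x HG Hx).
    assert (Hcx : Cmod (c * x) < 1) by (rewrite Cmod_mult, Hc; lra).
    assert (HBi : -1 <= B <= 1) by (apply Rabs_le_between, HB).
    assert (Hn := one_plus_mul_neq_0 B (c * x)%C HBi Hcx).
    replace (RtoC 0) with (C_derive F x * G x + F x * C_derive G x)%C; [exact D|].
    replace (C_derive F x) with (l * c * F x / (1 + B * (c * x)))%C
      by (rewrite <- E1; field; exact Hn).
    replace (C_derive G x) with ((- l)%R * c * G x / (1 + B * (c * x)))%C
      by (rewrite <- E2; field; exact Hn).
    rewrite RtoC_opp. field. exact Hn. }
  rewrite (pseries_on_center _ F (RtoC 0) 1 Rlt_0_1 HF),
    (pseries_on_center _ G (RtoC 0) 1 Rlt_0_1 HG) in HFG.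
  simpl in HFG. intros E. rewrite E in HFG.
  apply C1_nz. transitivity (1 * 1)%C; [ring|]. rewrite <- HFG. ring.
Qed.

Lemma rotation_to_negative_axis (v : C) :
  exists c : C, Cmod c = 1 /\ (c * v)%C = RtoC (- Cmod v).
Proof.
  destruct (Ceq_dec v (RtoC 0)) as [E|E].
  - exists (RtoC 1). rewrite E, Cmod_0, Cmod_1. split; [reflexivity|].
    rewrite Ropp_0. ring.
  - assert (Hv : 0 < Cmod v) by (apply Cmod_gt_0, E).
    assert (Hv' : RtoC (Cmod v) <> RtoC 0).
    { intros H. apply RtoC_inj in H. lra. }
    exists (- (Cconj v / Cmod v))%C. split.
    + rewrite Cmod_opp, Cmod_div, Cmod_conj, Cmod_RtoC_nonneg by (exact Hv' || lra).
      field. lra.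
    + transitivity (- ((v * Cconj v) / Cmod v))%C; [field; exact Hv'|].
      rewrite <- Cmod2_conj, RtoC_pow, RtoC_opp. field. exact Hv'.
Qed.

Lemma analytic_on_disk_rotation (c : C) : analytic_on_disk (fun w => c * w)%C.
Proof.
  intros z Hz.
  apply (pseries_on_analytic (fun n => if Nat.eq_dec n 1 then c else RtoC 0)
    (fun w => c * w)%C (RtoC 0) 1).
  2:{ replace (z - 0)%C with z by ring. exact Hz. }
  intros w _. replace (w - 0)%C with w by ring.
  unfold is_pseries, is_series.
  apply filterlim_ext_loc with (fun _ : nat => (c * w)%C).
  - exists 1%nat. intros n Hn. rewrite sum_n_partial_sum.
    destruct n as [|n]; [lia|]. clear Hn. induction n as [|n IH].
    + simpl. ring.
    + change (c * w = partial_sum (fun n => if Nat.eq_dec n 1 then c else RtoC 0) w (S (S n))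
        + 0 * w ^ S (S n))%C. rewrite <- IH. ring.
  - apply filterlim_const.
Qed.

(** [f] is a primitive of the binomial series, so that [f'] is that series; the
    Schwarz function is [w |-> c w]. *)
Lemma extremal_exists (A B : R) (c : C) :
  -1 <= B -> B < A -> A <= 1 -> Cmod c = 1 ->
  exists f, janowski A B f /\ forall w, Cmod w < 1 ->
    d1 f w <> RtoC 0 /\ ((1 + B * (c * w)) * d2 f w = (A - B)%R * c * d1 f w)%C.
Proof.
  intros hB hBA hA Hc.
  assert (Hl : Rabs (A - B) <= 2) by (apply Rabs_le_between; lra).
  assert (HB : Rabs B <= 1) by (apply Rabs_le_between; lra).
  set (a := binomial_coef c (A - B) B).
  set (b := fun n => match n with O => RtoC 0 | S m => (a m / INR (S m))%C end).
  destruct (pseries_on_linear_growth b) as [f Hf].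
  { intros [|n]; unfold b.
    - rewrite Cmod_0. simpl. lra.
    - assert (Hn : 0 < INR (S n)) by (apply lt_0_INR; lia).
      assert (Hn0 : RtoC (INR (S n)) <> RtoC 0).
      { intros E. apply RtoC_inj in E. lra. }
      rewrite Cmod_div, Cmod_RtoC_nonneg by (exact Hn0 || lra).
      apply Rmult_le_reg_r with (INR (S n)); [exact Hn|].
      unfold Rdiv. rewrite Rmult_assoc, Rinv_l, Rmult_1_r by lra.
      assert (H := binomial_coef_le c (A - B) B n Hc Hl HB). fold a in H.
      rewrite <- S_INR in H. apply Rle_trans with (1 := H).
      rewrite <- (Rmult_1_l (INR (S n))) at 1. apply Rmult_le_compat_r; lra. }
  assert (HF : pseries_on a (d1 f) (RtoC 0) 1).
  { intros w Hw. assert (H := pseries_on_C_derive b f (RtoC 0) 1 Hf w Hw).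
    apply (is_pseries_ext (K := C_AbsRing) (V := C_NormedModule)) with (2 := H).
    intros n. match goal with |- ?X = ?Y => change (@eq C X Y) end. unfold PS_derivC, b. field.
    intros E. apply RtoC_inj in E. revert E. apply not_0_INR. lia. }
  assert (Hmain : forall w, Cmod w < 1 -> d1 f w <> RtoC 0 /\
    ((1 + B * (c * w)) * d2 f w = (A - B)%R * c * d1 f w)%C).
  { intros w Hw. split.
    - exact (binomial_neq_0 c (A - B) B (d1 f) w Hc Hl HB HF Hw).
    - exact (binomial_ode c (A - B) B (d1 f) w HF Hw). }
  exists f. split; [|exact Hmain].
  assert (Hcw : forall w, Cmod w < 1 -> Cmod (c * w) < 1).
  { intros w Hw. rewrite Cmod_mult, Hc. lra. }
  split; [|split].
  - intros z Hz. apply (pseries_on_analytic b f (RtoC 0) 1 z Hf).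
    replace (z - 0)%C with z by ring. exact Hz.
  - intros z Hz. apply Hmain, Hz.
  - exists (fun w => c * w)%C. split; [apply analytic_on_disk_rotation|].
    split; [exact Hcw|]. split; [apply Cmult_0_r|].
    intros z Hz. destruct (Hmain z Hz) as [H1 H2].
    assert (Hn := one_plus_mul_neq_0 B (c * z)%C ltac:(lra) (Hcw z Hz)).
    replace (d2 f z) with ((A - B)%R * c * d1 f z / (1 + B * (c * z)))%C
      by (rewrite <- H2; field; exact Hn).
    rewrite RtoC_minus. field. split; assumption.
Qed.

Theorem theorem4p6 (A B : R) (hB : -1 <= B) (hBA : B < A) (hA : A <= 1) :
  (forall f : C -> C, janowski A B f ->
     forall z : C, unit_disk z ->
       Rbar_le (Finite (pole_bound A B z)) (ext_Cmod (pole f z))) /\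
  (forall z : C, unit_disk z ->
     exists f : C -> C, janowski A B f /\
       ext_Cmod (pole f z) = Finite (pole_bound A B z)).
Proof.
  split.
  - intros f Hf z Hz. apply pole_lower_bound; assumption.
  - intros z Hz.
    destruct (rotation_to_negative_axis ((A + B)%R * z)%C) as (c & Hc & Ec).
    destruct (extremal_exists A B c hB hBA hA Hc) as (f & Hf & H).
    exists f. split; [exact Hf|].
    destruct (H z Hz) as [H1 H2].
    assert (Hcz : Cmod (c * z) < 1) by (rewrite Cmod_mult, Hc; unfold unit_disk in Hz; lra).
    assert (Hn := one_plus_mul_neq_0 B (c * z)%C ltac:(lra) Hcz).
    assert (Hl : RtoC (A - B) <> RtoC 0).
    { intros E. apply RtoC_inj in E. lra. }
    assert (Hc0 : c <> RtoC 0) by (apply Cmod_gt_0; lra).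
    assert (E2 : d2 f z = ((A - B)%R * c * d1 f z / (1 + B * (c * z)))%C)
      by (rewrite <- H2; field; exact Hn).
    unfold pole. destruct (Ceq_dec (d2 f z) (RtoC 0)) as [E|E].
    { exfalso. rewrite E in H2.
      assert (Hp : ((A - B)%R * c * d1 f z)%C <> RtoC 0) by (repeat apply Cmult_neq_0; assumption).
      apply Hp. rewrite <- H2. ring. }
    simpl. f_equal. unfold pole_bound.
    rewrite Cmod_mult, Cmod_R in Ec.
    assert (Ep : (z + 2 * (d1 f z / d2 f z) = (2 + c * ((A + B)%R * z)) / ((A - B)%R * c))%C).
    { rewrite E2. rewrite RtoC_plus. rewrite RtoC_minus in Hl |- *. field.
      repeat split; assumption. }
    rewrite Ep, Ec, Cmod_div, Cmod_mult, Hc, (Cmod_RtoC_nonneg (A - B)), Rmult_1_r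
      by (lra || (apply Cmult_neq_0; assumption)).
    rewrite <- RtoC_plus, Cmod_RtoC_nonneg; [reflexivity|].
    assert (HAB : Rabs (A + B) <= 2) by (apply Rabs_le_between; lra).
    assert (Rabs (A + B) * Cmod z <= 2 * 1); [|lra].
    unfold unit_disk in Hz.
    apply Rmult_le_compat; [apply Rabs_pos | apply Cmod_ge_0 | lra | lra].
Qed.
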